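(* Let $\beta\in[0,1]$, $m>0$, $\sigma\ge0$, and let $C(\beta,m,\sigma)$ be the constant of the modified log-Sobolev inequality for convex functions recalled in the context. There is a constant $C'>0$ depending only on $\beta$ and $C(\beta,m,\sigma)$ (and additionally on $m+3\sigma$ in the case $\beta=0$) such that the following holds. Let $X_1,\dots,X_n$ be independent real random variables whose laws all belong to $\mathcal{M}_\beta(m,\sigma^{\beta+1})$ and let $A\subset\mathbb{R}^n$ be a convex set with $\mathbb{P}((X_1,\dots,X_n)\in A)\ge1/2$. Then, for all $r\ge0$, $$\mathbb{P}\big((X_1,\dots,X_n)\notin A+r^{1/2}B_2+r^{1/(1+\beta)}B_{1+\beta}\big)\le e^{-C'r}.$$
   Context: $B_p=\{x\in\mathbb{R}^n:\|x\|_p\le1\}$ is the unit ball of the $\ell_p^n$ norm $\|\cdot\|_p$, $|\cdot|=\|\cdot\|_2$, and sums of sets are Minkowski sums. For $\beta\in[0,1]$, $m>0$, $\sigma\ge 0$, $\mathcal{M}_\beta(m,\sigma^{\beta+1})$ denotes the class of probability measures $\mu$ on $\mathbb{R}$ such that $$\forall_{x\ge m}\ \ \nu^+([x,\infty))\le\sigma^{\beta+1}\mu([x,\infty)),\qquad \forall_{x\le -m}\ \ \nu^-((-\infty,x])\le\sigma^{\beta+1}\mu((-\infty,x]),$$ where $\nu^+$ is the measure on $[m,\infty)$ with (Lebesgue) density $x^\beta\mu([x,\infty))$ and $\nu^-$ is the measure on $(-\infty,-m]$ with density $|x|^\beta\mu((-\infty,x])$. The constant $C=C(\beta,m,\sigma)\in(0,\infty)$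 is a constant, depending only on $\beta,m,\sigma$, such that for every $n\ge1$, all independent $X_1,\dots,X_n$ with laws in $\mathcal{M}_\beta(m,\sigma^{\beta+1})$ (write $X=(X_1,\dots,X_n)$) and every smooth convex $\psi\colon\mathbb{R}^n\to\mathbb{R}$: - if $\beta\in(0,1]$, $\operatorname{Ent}e^{\psi(X)}\le C\,\mathbb{E}\big[\big(|\nabla\psi(X)|^2\vee\|\nabla\psi(X)\|_{(\beta+1)/\beta}^{(\beta+1)/\beta}\big)e^{\psi(X)}\big]$; - if $\beta=0$ and $|\partial_i\psi|\le 1/(2(m+3\sigma))$ everywhere for all $i$, $\operatorname{Ent}e^{\psi(X)}\le C\,\mathbb{E}\big[|\nabla\psi(X)|^2e^{\psi(X)}\big]$. (Such a constant exists by a theorem of the same paper.) Here $\operatorname{Ent}Y=\mathbb{E}Y\log Y-\mathbb{E}Y\log\mathbb{E}Y$ if $\mathbb{E}Y\log Y<\infty$ and $\operatorname{Ent}Y=\infty$ otherwise. *)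

(* Defs.v *)
From HB Require Import structures.
From mathcomp Require Export all_boot all_order all_algebra.
From mathcomp Require Export all_classical all_reals all_analysis.

Set Implicit Arguments.
Unset Strict Implicit.
Unset Printing Implicit Defensive.

Export Order.TTheory GRing.Theory Num.Theory.
Export numFieldNormedType.Exports.

Local Open Scope classical_set_scope.
Local Open Scope ring_scope.

Definition lp_norm (R : realType) (n : nat) (p : R) (x : 'rV[R]_n) : R :=
  (\sum_(i < n) `|x 0 i| `^ p) `^ p^-1.

Definition lp_ball (R : realType) (n : nat) (p : R) : set 'rV[R]_n :=
  [set x | lp_norm p x <= 1].
Arguments lp_ball {R} n p.

Definition dilate (R : realType) (n : nat) (c : R) (A : set 'rV[R]_n) :
  set 'rV[R]_n := [set c *: x | x in A].

Definition minkowski_sum (R : realType) (n : nat) (A B : set 'rV[R]_n) :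
  set 'rV[R]_n := [set x + y | x in A & y in B].

Definition partial (R : realType) (n : nat) (i : 'I_n) (f : 'rV[R]_n -> R) :
  'rV[R]_n -> R := fun x => 'D_(delta_mx 0 i) f x.

Definition grad (R : realType) (n : nat) (f : 'rV[R]_n -> R) (x : 'rV[R]_n) :
  'rV[R]_n := \row_i partial i f x.

(* The derivative operator 'D is total, so smoothness must also require
   derivability: all iterated partial derivatives exist and are continuous. *)
Definition iter_partial (R : realType) (n : nat) (s : seq 'I_n)
  (f : 'rV[R]_n -> R) : 'rV[R]_n -> R := foldr (@partial R n) f s.

Definition smooth (R : realType) (n : nat) (f : 'rV[R]_n -> R) : Prop :=
  forall s : seq 'I_n,
    continuous (iter_partial s f) /\
    forall (i : 'I_n) (x : 'rV[R]_n),
      derivable (iter_partial s f) x (delta_mx 0 i).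

Section tail_class.
Local Open Scope ereal_scope.

Definition nu_plus (R : realType) (beta m : R)
    (mu : probability R R) (E : set R) : \bar R :=
  \int[lebesgue_measure]_(y in E `&` `[m, +oo[%classic)
    ((y `^ beta)%R%:E * mu `[y, +oo[%classic).

Definition nu_minus (R : realType) (beta m : R)
    (mu : probability R R) (E : set R) : \bar R :=
  \int[lebesgue_measure]_(y in E `&` `]-oo, (- m)%R]%classic)
    ((`|y| `^ beta)%R%:E * mu `]-oo, y]%classic).

(* [tail_class beta m s] is the class written M_beta(m, s); it is used with
   s = sigma ^ (beta + 1). *)
Definition tail_class (R : realType) (beta m s : R)
    (mu : probability R R) : Prop :=
  (forall x : R, (m <= x)%R ->
     nu_plus beta m mu `[x, +oo[%classic <= s%:E * mu `[x, +oo[%classic) /\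
  (forall x : R, (x <= - m)%R ->
     nu_minus beta m mu `]-oo, x]%classic <= s%:E * mu `]-oo, x]%classic).

Definition independent (d : measure_display) (T : measurableType d)
    (R : realType) (P : probability T R) (n : nat)
    (X : 'I_n -> {RV P >-> R}) : Prop :=
  forall (J : {set 'I_n}) (B : 'I_n -> set R),
    (forall i, measurable (B i)) ->
    P (\bigcap_(i in [set` J]) (X i @^-1` B i)) =
    \prod_(i in J) P (X i @^-1` B i).

(* Meant for Y >= 0; ln 0 = 0 in the library, so Y * ln Y is 0 where Y = 0.
   If 'E_P[Y ln Y] < +oo then 'E_P[Y] is finite, so [fine] loses nothing. *)
Definition entropy (d : measure_display) (T : measurableType d)
    (R : realType) (P : probability T R) (Y : T -> R) : \bar R :=
  if 'E_P[fun w => (Y w * ln (Y w))%R] < +oo then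
    'E_P[fun w => (Y w * ln (Y w))%R] -
      (fine 'E_P[Y] * ln (fine 'E_P[Y]))%R%:E
  else +oo.

End tail_class.

Definition rvec (d : measure_display) (T : measurableType d) (R : realType)
    (P : probability T R) (n : nat) (X : 'I_n -> {RV P >-> R}) (w : T) :
  'rV[R]_n := \row_i X i w.

(* C is admissible in the modified log-Sobolev inequality for convex functions
   with parameters beta, m, sigma. *)
Definition mlsi_constant (R : realType) (beta m sigma C : R) : Prop :=
  0 < C /\
  forall (d : measure_display) (T : measurableType d) (P : probability T R)
    (n : nat) (X : 'I_n -> {RV P >-> R}) (psi : 'rV[R]_n -> R),
    (0 < n)%N ->
    independent X ->
    (forall i, tail_class beta m (sigma `^ (beta + 1)) (distribution P (X i))) ->
    smooth psi ->
    convex_function (E := 'rV[R]_n) setT psi ->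
    (0 < beta ->
      let p := (beta + 1) / beta in
      (entropy P (fun w => expR (psi (rvec X w))) <=
       C%:E * 'E_P[fun w =>
         (Num.max (lp_norm 2 (grad psi (rvec X w)) ^+ 2)
                  (lp_norm p (grad psi (rvec X w)) `^ p)
          * expR (psi (rvec X w)))%R])%E) /\
    (beta = 0 ->
      (forall (i : 'I_n) (x : 'rV[R]_n),
         `|partial i psi x| <= 1 / (2 * (m + 3 * sigma))) ->
      (entropy P (fun w => expR (psi (rvec X w))) <=
       C%:E * 'E_P[fun w =>
         (lp_norm 2 (grad psi (rvec X w)) ^+ 2 * expR (psi (rvec X w)))%R])%E).

(* Main.v *)
(* Fix [r > 0] and put [K = r^(1/2) B_2 + r^(1/(1+beta)) B_(1+beta)].
   - Clipping the variables to [-M, M] keeps them independent and in the tail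
     class, so they may be taken bounded, and only the part of the complement of
     [A + K] in a cube matters.
   - By Hahn-Banach each point outside [A + K] is separated from it by an affine
     function that is [<= 0] on [A], [>= 1] at the point, and whose linear part
     is in the polar of [K].  Finitely many of these suffice up to a small error,
     and their (normalized) log-sum-exp [h] is smooth, convex, [<= 0] on [A],
     [>= 3/4] off [A + K], with gradient in the polar of [K].  This makes the
     gradient term of the inequality at most [l^2 / r] for [psi = l h], [l <= r].
   - A derivative-free Herbst argument: [Ent Y >= E Y (ln E Y - 2 ln E (sqrt Y))]
     turns the log-Sobolev inequality into
     [E exp (l h) <= exp (C l^2 / r) (E exp (l h / 2))^2].  At small [l], since
     [h <= 0] with probability close to 1/2, this bounds [E exp (l h)] by an
     absolute constant; doubling [l] up to order [r] and Markov's inequality give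
     the bound for large [r].  For small [r] the probability is at most 1/2. *)
From HB Require Import structures.
Require Import Defs.
From mathcomp Require Import ring lra unstable measurable_realfun.

Set Implicit Arguments.
Unset Strict Implicit.
Unset Printing Implicit Defensive.

Local Open Scope classical_set_scope.
Local Open Scope ring_scope.

(** * Separation of convex sets *)

Definition sublinear (R : realType) (V : lmodType R) (p : V -> R) : Prop :=
  (forall x y, p (x + y) <= p x + p y) /\
  (forall t x, 0 <= t -> p (t *: x) = t * p x).

(** One step of Hahn-Banach: [q x], the infimum over [t >= 0] of [p (x + t *: e) - t * p e], is
    finite because [- p (- x)] bounds it below, and replacing [p] by [q] makes it linear along the
    line of [e]. *)
Lemma sublinear_odd_at (R : realType) (V : lmodType R) (p : V -> R) (e : V) :
  sublinear p -> exists q : V -> R,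
    [/\ sublinear q, forall x, q x <= p x, q (- e) = - q e & q e = p e].
Proof.
move=> [pD pZ].
pose S x := [set p (x + t *: e) - t * p e | t in [set t | 0 <= t]].
have p0 : p 0 = 0 by rewrite -(scale0r 0) pZ // mul0r.
have lbS x : lbound (S x) (- p (- x)).
  move=> _ [t /= t0 <-]; have := pD (x + t *: e) (- x).
  rewrite addrAC subrr add0r pZ //; lra.
have nS x : S x !=set0 by exists (p (x + 0 *: e) - 0 * p e); exists 0 => /=.
have hS x : has_inf (S x) by split; [exact: nS | exists (- p (- x)); exact: lbS].
pose q x := inf (S x).
have q_le x t : 0 <= t -> q x <= p (x + t *: e) - t * p e.
  by move=> t0; apply: ge_inf; [exact: (hS x).2 | exists t].
have qp x : q x <= p x by have := q_le x 0 (lexx _); rewrite scale0r addr0; lra.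
have q_ge x y : (forall t, 0 <= t -> y <= p (x + t *: e) - t * p e) -> y <= q x.
  by move=> h; apply: lb_le_inf; [exact: nS | move=> _ [t /= t0 <-]; exact: h].
have qD x y : q (x + y) <= q x + q y.
  rewrite -lerBlDr; apply: (q_ge) => t t0; rewrite lerBlDr -lerBlDl.
  apply: (q_ge) => u u0; rewrite lerBlDl.
  apply: (le_trans (q_le _ (t + u) (addr_ge0 t0 u0))).
  have := pD (x + t *: e) (y + u *: e).
  by rewrite addrACA -scalerDl; lra.
have q0 : q 0 = 0.
  apply/eqP; rewrite eq_le; apply/andP; split; first by rewrite -p0.
  by apply: (q_ge) => t t0; rewrite add0r pZ //; lra.
have qZ t x : 0 <= t -> q (t *: x) = t * q x.
  rewrite le_eqVlt => /predU1P[<-|t0]; first by rewrite scale0r q0 mul0r.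
  apply/eqP; rewrite eq_le; apply/andP; split.
    rewrite -ler_pdivrMl //; apply: (q_ge) => u u0; rewrite ler_pdivrMl //.
    apply: (le_trans (q_le _ (t * u) _)); first by rewrite mulr_ge0 // ltW.
    by rewrite -scalerA -scalerDr pZ ?(ltW t0) // mulrBr mulrA.
  apply: (q_ge) => u u0.
  rewrite -ler_pdivlMl //; apply: (le_trans (q_le _ (u / t) _)).
    by rewrite divr_ge0 // ltW.
  rewrite ler_pdivlMl // mulrBr -(pZ t) ?(ltW t0) // scalerDr scalerA !mulrA.
  by rewrite [t * u]mulrC mulfK ?gt_eqF.
have qe : q (- e) <= - p e.
  by have := q_le (- e) 1 ler01; rewrite scale1r addNr p0; lra.
have := qD e (- e); rewrite subrr q0 => qee.
have qpe := qp e.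
exists q; split => //; lra.
Qed.

(** Induction with the one-step lemma. The point [x0] is treated first, so that oddness there
    freezes the value [p x0] in all later steps. *)
Lemma sublinear_odd_on (R : realType) (V : lmodType R) (p : V -> R) (x0 : V)
    (s : seq V) :
  sublinear p -> exists q : V -> R,
    [/\ sublinear q, forall x, q x <= p x, q x0 = p x0 &
        forall e, e \in s -> q (- e) = - q e].
Proof.
move=> sp; suff: exists q : V -> R,
    [/\ sublinear q, forall x, q x <= p x, q x0 = p x0 &
        forall e, e \in x0 :: s -> q (- e) = - q e].
  move=> [q [sq qp q0 qs]]; exists q; split => // e es.
  by apply: qs; rewrite inE es orbT.
(* Oddness survives passage to a smaller sublinear function: [0 <= q e + q (- e) <= q' e + q' (- e)
   = 0] forces equality in both terms. *)
have odd_le (q q' : V -> R) e : sublinear q -> (forall x, q x <= q' x) ->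
    q' (- e) = - q' e -> q (- e) = - q e /\ q e = q' e.
  move=> [qD qZ] qq' q'e; have := qD e (- e).
  rewrite subrr -[X in q X](scale0r 0) qZ // mul0r.
  have := qq' e; have := qq' (- e); rewrite q'e; lra.
elim: s => [|e s [q [sq qp q0 qs]]].
  have [q [sq qp qN qe]] := sublinear_odd_at x0 sp.
  by exists q; split => // e; rewrite inE => /eqP ->.
have [q' [sq' q'q q'N q'e]] := sublinear_odd_at e sq.
exists q'; split => //.
- by move=> x; exact: le_trans (q'q x) (qp x).
- rewrite -q0; have := qs x0; rewrite mem_head => /(_ isT) h.
  by have [] := odd_le _ _ _ sq' q'q h.
- move=> f; rewrite !inE orbCA => /orP[/eqP -> //|fs].
  by have [] := odd_le _ _ f sq' q'q (qs f _); rewrite ?inE.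
Qed.

Definition dot (R : realType) (n : nat) (v x : 'rV[R]_n) : R :=
  \sum_(i < n) v 0 i * x 0 i.

Section dot.
Context {R : realType} {n : nat}.
Implicit Types v x y : 'rV[R]_n.

Lemma dotDr v x y : dot v (x + y) = dot v x + dot v y.
Proof. by rewrite -big_split; apply: eq_bigr => i _; rewrite mxE mulrDr. Qed.

Lemma dotZr v x (t : R) : dot v (t *: x) = t * dot v x.
Proof. by rewrite mulr_sumr; apply: eq_bigr => i _; rewrite mxE mulrCA. Qed.

Lemma dotZl v x (t : R) : dot (t *: v) x = t * dot v x.
Proof. by rewrite mulr_sumr; apply: eq_bigr => i _; rewrite mxE mulrA. Qed.

Lemma dotBr v x y : dot v (x - y) = dot v x - dot v y.
Proof. by rewrite dotDr -scaleN1r dotZr mulN1r. Qed.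

Lemma dot_delta v (i : 'I_n) : dot v (delta_mx 0 i) = v 0 i.
Proof.
rewrite /dot (bigD1 i) //= big1 ?addr0 => [|j ji]; rewrite mxE eqxx /=.
  by rewrite eqxx mulr1.
by rewrite (negPf ji) mulr0.
Qed.

End dot.

(** A sublinear minorant odd on the standard basis is at most the linear form with the same basis
    values; comparing at [x] and at [- x] shows that it equals this form. *)
Lemma hahn_banach_rV (R : realType) (n : nat) (p : 'rV[R]_n -> R)
    (x0 : 'rV[R]_n) : sublinear p ->
  exists v, (forall x, dot v x <= p x) /\ dot v x0 = p x0.
Proof.
move=> sp.
have [q [[qD qZ] qp q0 qs]] :=
  sublinear_odd_on x0 [seq delta_mx 0 i | i <- enum 'I_n] sp.
have q00 : q 0 = 0 by rewrite -(scale0r 0) qZ // mul0r.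
have qd (i : 'I_n) t : q (t *: delta_mx 0 i) = t * q (delta_mx 0 i).
  have [t0|t0] := leP 0 t; first exact: qZ.
  rewrite -[t]opprK scaleNr -scalerN qZ ?oppr_ge0 ?ltW //.
  by rewrite qs ?mulrN ?mulNr // map_f // mem_enum.
pose v : 'rV[R]_n := \row_i q (delta_mx 0 i).
have qv x : q x <= dot v x.
  rewrite {1}(row_sum_delta x) /dot.
  apply: (big_ind2 (fun a b => q a <= b)); rewrite ?q00 //.
    by move=> a b c d ab cd; exact: le_trans (qD _ _) (lerD ab cd).
  by move=> i _; rewrite qd mxE mulrC.
have vq x : dot v x = q x.
  apply/eqP; rewrite eq_le qv andbT.
  have := qD x (- x); rewrite subrr q00 => h.
  have := qv (- x); rewrite -scaleN1r dotZr scaleN1r; lra.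
by exists v; split => [x|]; rewrite vq.
Qed.

Definition cvx (R : realType) (n : nat) (S : set 'rV[R]_n) : Prop :=
  forall x y t, 0 <= t <= 1 -> S x -> S y -> S (t *: x + (1 - t) *: y).

(** For convex sets of row vectors this amounts to having 0 in the interior, said without
    topology. *)
Definition absorbing (R : realType) (n : nat) (S : set 'rV[R]_n) : Prop :=
  forall x, exists2 t, 0 < t & S (t *: x).

Lemma cvx_shrink (R : realType) (n : nat) (S : set 'rV[R]_n) x t :
  cvx S -> S 0 -> 0 <= t <= 1 -> S x -> S (t *: x).
Proof. by move=> cS S0 t01 Sx; have := cS _ _ _ t01 Sx S0; rewrite scaler0 addr0. Qed.

(** Hahn-Banach is applied to the Minkowski gauge [p] of [S]. It is at most 1 on [S], and at least 1
    at [x0], since [S] is stable under shrinking towards 0. *)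
Lemma separate_absorbing (R : realType) (n : nat) (S : set 'rV[R]_n) x0 :
  cvx S -> S 0 -> absorbing S -> ~ S x0 ->
  exists v, (forall x, S x -> dot v x <= 1) /\ 1 <= dot v x0.
Proof.
move=> cS S0 aS Sx0.
pose G x := [set t : R | 0 < t /\ S (t^-1 *: x)].
have nG x : G x !=set0.
  have [t t0 St] := aS x; exists t^-1.
  by split; rewrite /= ?invr_gt0 ?invrK.
have lbG x : lbound (G x) 0 by move=> t [/ltW].
have hG x : has_inf (G x) by split; [exact: nG | exists 0; exact: lbG].
pose p x := inf (G x).
have p_ge0 x : 0 <= p x by apply: lb_le_inf; [exact: nG | exact: lbG].
have p_le x t : 0 < t -> S (t^-1 *: x) -> p x <= t.
  by move=> t0 St; apply: ge_inf; [exact: (hG x).2 |].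
have p_ge x y : (forall t, 0 < t -> S (t^-1 *: x) -> y <= t) -> y <= p x.
  by move=> h; apply: lb_le_inf; [exact: nG | move=> t [t0 St]; exact: h].
have p0 : p 0 = 0.
  apply/eqP; rewrite eq_le p_ge0 andbT; apply/ler_addgt0Pl => e e0.
  by rewrite addr0; apply: (p_le) => //; rewrite scaler0.
have sp : sublinear p.
  split => [x y|t x].
    rewrite -lerBlDr; apply: (p_ge) => t t0 St; rewrite lerBlDr -lerBlDl.
    apply: (p_ge) => u u0 Su; rewrite lerBlDl.
    apply: (p_le); first by rewrite addr_gt0.
    have tu0 : t + u != 0 by rewrite gt_eqF // addr_gt0.
    (* The point [(x + y) / (t + u)] is the convex combination of [x / t] and [y / u] with weights
       [t / (t + u)] and [u / (t + u)]. *)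
    have := cS _ _ (t / (t + u)) _ St Su; rewrite !scalerA.
    have -> : t / (t + u) / t = (t + u)^-1 by field; rewrite tu0 gt_eqF.
    have -> : (1 - t / (t + u)) / u = (t + u)^-1 by field; rewrite tu0 gt_eqF.
    rewrite -scalerDr; apply.
    by rewrite divr_ge0 ?ler_pdivrMr ?addr_gt0 ?mul1r ?lerDl ?ltW // addr_gt0.
  rewrite le_eqVlt => /predU1P[<-|t0]; first by rewrite scale0r p0 mul0r.
  apply/eqP; rewrite eq_le; apply/andP; split.
    rewrite -ler_pdivrMl //; apply: (p_ge) => u u0 Su; rewrite ler_pdivrMl //.
    apply: (p_le); first exact: mulr_gt0.
    by rewrite scalerA invfM mulrAC mulVf ?gt_eqF // mul1r.
  apply: (p_ge) => u u0 Su; rewrite -ler_pdivlMl // mulrC; apply: (p_le).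
    by rewrite divr_gt0.
  by rewrite invf_div mulrC -scalerA.
have [v [vp vx0]] := hahn_banach_rV x0 sp.
exists v; split => [x Sx|].
  by apply: le_trans (vp x) _; apply: (p_le); rewrite ?invr1 ?scale1r.
rewrite vx0; apply: (p_ge) => t t0 St; rewrite leNgt; apply/negP => t1; apply: Sx0.
have := cvx_shrink cS S0 _ St (t := t).
by rewrite scalerA divff ?gt_eqF // scale1r; apply; rewrite !ltW.
Qed.

(** Translating by a point of [A] makes the sum absorbing. The functional so obtained is then
    divided by its gap [w] between [x0] and the supremum over [A], which puts it in the polar of
    [K]. *)
Lemma separate_minkowski_sum (R : realType) (n : nat) (A K : set 'rV[R]_n) x0 :
  cvx A -> A !=set0 -> cvx K -> K 0 -> absorbing K ->
  ~ minkowski_sum A K x0 ->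
  exists v c, [/\ forall a, A a -> dot v a <= c,
                  forall k, K k -> dot v k <= 1 & c + 1 <= dot v x0].
Proof.
move=> cA [a0 Aa0] cK K0 aK AKx0.
pose S := [set z | minkowski_sum A K (a0 + z)].
have [||||v [vS vx]] := @separate_absorbing _ _ S (x0 - a0).
- move=> x y t t01 [a Aa [k Kk akx]] [b Ab [l Kl bly]].
  exists (t *: a + (1 - t) *: b); first exact: cA.
  exists (t *: k + (1 - t) *: l); first exact: cK.
  rewrite addrACA -!scalerDr akx bly !scalerDr addrACA -scalerDl.
  by rewrite [t + _]addrC subrK scale1r.
- by exists a0 => //; exists 0.
- by move=> x; have [t t0 Kt] := aK x; exists t => //; exists a0 => //; exists (t *: x).
- by rewrite /S /= addrCA subrr addr0.
have vak a k : A a -> K k -> dot v a + dot v k <= dot v x0.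
  move=> Aa Kk; have := vS (a + k - a0).
  have Sx : S (a + k - a0) by exists a => //; exists k => //; rewrite addrCA subrr addr0.
  by move=> /(_ Sx); move: vx; rewrite !dotBr dotDr; lra.
pose E := [set dot v a | a in A].
have hE : has_sup E.
  split; first by exists (dot v a0), a0.
  exists (dot v x0) => _ [a Aa <-]; have := vak a 0 Aa K0.
  by rewrite -(scale0r 0) dotZr mul0r addr0.
pose c := sup E.
have Ac a : A a -> dot v a <= c.
  by move=> Aa; apply: ub_le_sup; [exact: hE.2 | exists a].
have cK' k : K k -> c + dot v k <= dot v x0.
  move=> Kk; rewrite -lerBrDr; apply: ge_sup; first exact: hE.1.
  by move=> _ [a Aa <-]; rewrite lerBrDr; exact: vak.
(* The gap is positive because [K] contains a positive multiple of [v], and [v] is nonzero by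
   [vx]. *)
have w0 : 0 < dot v x0 - c.
  have [t t0 Kt] := aK v.
  have : 0 <= dot v v by apply: sumr_ge0 => i _; rewrite -expr2 sqr_ge0.
  rewrite le_eqVlt => /predU1P[|vv0].
    move=> /esym /eqP; rewrite psumr_eq0 => [/allP v0|i _]; last first.
      by rewrite -expr2 sqr_ge0.
    have {}v0 z : dot v z = 0.
      apply: big1 => i _; have := v0 i; rewrite mem_index_enum => /(_ isT).
      by rewrite mulf_eq0 orbb => /eqP ->; rewrite mul0r.
    by move: vx; rewrite v0 ler10.
  have := cK' _ Kt; rewrite dotZr.
  by have := mulr_gt0 t0 vv0; lra.
pose w := dot v x0 - c; have wN0 : w != 0 by rewrite gt_eqF.
exists (w^-1 *: v), (w^-1 * c); split => [a Aa|k Kk|]; rewrite dotZl.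
- by rewrite ler_pM2l ?invr_gt0 // Ac.
- by rewrite ler_pdivrMl // mulr1 lerBrDl cK'.
- by rewrite -lerBrDl -mulrBr -/w mulVf.
Qed.

(** * Balls of l_p norms and their polars *)

Section lp_ball.
Context {R : realType} {n : nat}.
Implicit Types (p q t : R) (x y v : 'rV[R]_n) (A K : set 'rV[R]_n).

Definition lp_sum p x : R := \sum_(i < n) `|x 0 i| `^ p.

Lemma lp_sum_ge0 p x : 0 <= lp_sum p x.
Proof. by apply: sumr_ge0 => i _; exact: powR_ge0. Qed.

Lemma lp_sumZ p t x : 0 <= t -> lp_sum p (t *: x) = t `^ p * lp_sum p x.
Proof.
move=> t0; rewrite mulr_sumr; apply: eq_bigr => i _.
by rewrite mxE normrM ger0_norm // powRM.
Qed.

Lemma lp_norm_powR p x : 0 < p -> lp_norm p x `^ p = lp_sum p x.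
Proof.
by move=> p0; rewrite -powRrM mulVf ?gt_eqF// powRr1 // lp_sum_ge0.
Qed.

Lemma lp_norm2_sqr x : lp_norm 2 x ^+ 2 = lp_sum 2 x.
Proof. by rewrite -powR_mulrn ?powR_ge0 // lp_norm_powR. Qed.

Lemma lp_ballE p x : 0 < p -> lp_ball n p x <-> lp_sum p x <= 1.
Proof.
move=> p0; rewrite -(lp_norm_powR x p0) /lp_ball /=.
have pow1 : 1 `^ p = 1 :> R by rewrite powR1.
split => h.
  rewrite -[leRHS]pow1; apply: ge0_ler_powR h; rewrite ?nnegrE ?powR_ge0 ?ltW //.
rewrite leNgt; apply/negP => h1; move: h; rewrite leNgt => /negP; apply.
by rewrite -[ltLHS]pow1 gt0_ltr_powR // nnegrE ?ler01 ?powR_ge0.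
Qed.

(** The ball is a sublevel set of [lp_sum], which is convex term by term. *)
Lemma cvx_lp_ball p : 1 <= p -> cvx (lp_ball n p).
Proof.
move=> p1 x y t t01; have p0 : 0 < p by exact: lt_le_trans p1.
rewrite !lp_ballE // => xp yp.
have t'0 : 0 <= 1 - t by rewrite subr_ge0; case/andP: t01.
have t0 : 0 <= t by case/andP: t01.
apply: (@le_trans _ _ (t * lp_sum p x + (1 - t) * lp_sum p y)); last first.
  have := ler_wpM2l t0 xp; have := ler_wpM2l t'0 yp; lra.
rewrite !mulr_sumr -big_split; apply: ler_sum => i _ /=; rewrite !mxE.
apply: (@le_trans _ _ ((t * `|x 0 i| + (1 - t) * `|y 0 i|) `^ p)).
  apply: ge0_ler_powR; rewrite ?nnegrE ?normr_ge0 ?addr_ge0 ?mulr_ge0 ?(ltW p0)//.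
  by rewrite (le_trans (ler_normD _ _)) // !normrM !(ger0_norm t0) (ger0_norm t'0).
have := @convex_powR R p p1 (Itv01 t0 _) `|x 0 i| `|y 0 i|.
have t1 : t <= 1 by case/andP: t01.
by move=> /(_ t1); apply; rewrite inE /= in_itv /= normr_ge0.
Qed.

Lemma lp_ball0 p : 0 < p -> lp_ball n p 0.
Proof.
move=> p0; apply/lp_ballE => //; rewrite /lp_sum big1 ?ler01 // => i _.
by rewrite mxE normr0 powR0 // gt_eqF.
Qed.

Lemma absorbing_lp_ball p : 0 < p -> absorbing (lp_ball n p).
Proof.
move=> p0 x; pose s := 1 + lp_sum p x.
have s0 : 0 < s by rewrite ltr_pwDl // lp_sum_ge0.
exists (s `^ (- p^-1)); first exact: powR_gt0.
apply/lp_ballE => //; rewrite lp_sumZ ?powR_ge0 // -powRrM mulNr mulVf ?gt_eqF //.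
by rewrite powR_inv1 ?(ltW s0) // ler_pdivrMl // mulr1 lerDr ler01.
Qed.

Lemma cvx_dilate t A : cvx A -> cvx (dilate t A).
Proof.
move=> cA _ _ s s01 [x Ax <-] [y Ay <-]; exists (s *: x + (1 - s) *: y).
  exact: cA.
by rewrite scalerDr !scalerA mulrC [t * _]mulrC.
Qed.

Lemma absorbing_dilate t A : 0 < t -> absorbing A -> absorbing (dilate t A).
Proof.
move=> t0 aA x; have [s s0 As] := aA x; exists (t * s); first exact: mulr_gt0.
by exists (s *: x) => //; rewrite scalerA.
Qed.

Lemma cvx_minkowski_sum A K : cvx A -> cvx K -> cvx (minkowski_sum A K).
Proof.
move=> cA cK _ _ s s01 [a Aa [k Kk <-]] [b Ab [l Kl <-]].
exists (s *: a + (1 - s) *: b); first exact: cA.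
exists (s *: k + (1 - s) *: l); first exact: cK.
by rewrite addrACA -!scalerDr.
Qed.

Lemma minkowski_sumA A K L :
  minkowski_sum A (minkowski_sum K L) = minkowski_sum (minkowski_sum A K) L.
Proof.
apply/seteqP; split => z.
  move=> [a Aa [_ [k Kk [l Ll <-]] <-]].
  by exists (a + k); [exists a => //; exists k | exists l => //; rewrite addrA].
move=> [_ [a Aa [k Kk <-]] [l Ll <-]].
exists a => //; exists (k + l); last by rewrite addrA.
by exists k => //; exists l.
Qed.

(* Equality in Hoelder's inequality is attained at
   [y_i = sg (v_i) |v_i|^(p-1) / (sum_j |v_j|^p)^(1/q)]. *)
Lemma polar_lp_ball p q t v : 0 < p -> 0 < q -> (p - 1) * q = p -> 0 <= t ->
  (forall y, lp_ball n q y -> dot v (t *: y) <= 1) ->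
  t `^ p * lp_sum p v <= 1.
Proof.
move=> p0 q0 pq t0 h.
have p1 : 0 < p - 1 by rewrite -(pmulr_lgt0 _ q0) pq.
have := lp_sum_ge0 p v; rewrite le_eqVlt => /predU1P[<-|N0].
  by rewrite mulr0 ler01.
pose N := lp_sum p v; rewrite -/N in N0 *.
pose y : 'rV[R]_n := \row_i (Num.sg (v 0 i) * `|v 0 i| `^ (p - 1)).
have yq : lp_sum q y = N.
  apply: eq_bigr => i _; rewrite mxE normrM normr_sg (ger0_norm (powR_ge0 _ _)).
  have [->|v0] := eqVneq (v 0 i) 0.
    by rewrite mul0r normr0 !powR0 ?gt_eqF.
  by rewrite mul1r -powRrM pq.
have vy : dot v y = N.
  apply: eq_bigr => i _; rewrite mxE mulrA [v 0 i * _]mulrC -normrEsg.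
  have [->|v0] := eqVneq (v 0 i) 0; first by rewrite normr0 mul0r powR0 ?gt_eqF.
  rewrite -[X in X * _](powRr1 (normr_ge0 _)) -powRD ?subrKC //.
  by rewrite normr_eq0 v0 implybT.
have /h : lp_ball n q (N `^ (- q^-1) *: y).
  apply/lp_ballE => //; rewrite lp_sumZ ?powR_ge0 // yq -powRrM mulNr mulVf ?gt_eqF //.
  by rewrite powR_inv1 ?(ltW N0) // mulVf ?gt_eqF.
rewrite !dotZr vy -{2}(powRr1 (ltW N0)) -powRD ?(gt_eqF N0) ?implybT // => H.
have qp : - q^-1 + 1 = p^-1.
  have p10 : p - 1 != 0 by rewrite gt_eqF.
  have -> : q = p / (p - 1) by rewrite -{1}pq mulrAC mulfV ?mul1r.
  by field; rewrite p10 gt_eqF.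
have : (t * N `^ p^-1) `^ p <= 1 `^ p.
  apply: ge0_ler_powR; rewrite ?nnegrE ?mulr_ge0 ?powR_ge0 ?ler01 ?(ltW p0) //.
  by rewrite -qp.
by rewrite powR1 powRM ?powR_ge0 // -powRrM mulVf ?gt_eqF // powRr1 // ltW.
Qed.

(** Tested on the signed basis vectors, the extreme points of the ball; the sign is 0 when the
    coordinate of [v] vanishes, which still lies in the ball. *)
Lemma polar_l1_ball t v : 0 <= t ->
  (forall y, lp_ball n 1 y -> dot v (t *: y) <= 1) ->
  forall i, t * `|v 0 i| <= 1.
Proof.
move=> t0 h i.
have /h : lp_ball n 1 (Num.sg (v 0 i) *: delta_mx 0 i).
  apply/lp_ballE => //; rewrite /lp_sum (bigD1 i) //= big1 => [|j ji].
    rewrite addr0 !mxE !eqxx mulr1 powRr1 // normr_sg.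
    by case: (_ != _); rewrite ?ler01 ?lexx.
  by rewrite !mxE eqxx (negPf ji) mulr0 normr0 powR0.
by rewrite !dotZr dot_delta -normrEsg.
Qed.

End lp_ball.

(** * The log-sum-exp function *)

(** Both sides have the same difference quotient; this brings directional derivatives within reach
    of the one-variable chain rule. *)
Lemma is_derive_lineE (R : realType) (V : normedModType R) (f : V -> R)
    (x v : V) (d : R) :
  is_derive (0 : R) 1 (fun t => f (x + t *: v)) d <-> is_derive x v f d.
Proof.
have E : (fun h : R => h^-1 *:
    (((fun t => f (x + t *: v)) \o shift 0) (h *: (1 : R)) - f (x + 0 *: v))) =
    (fun h : R => h^-1 *: ((f \o shift x) (h *: v) - f x)).
  apply/funext => h /=; congr (_ *: (f _ - f _)); last by rewrite scale0r addr0.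
  by rewrite addr0 addrC /GRing.scale /= mulr1.
by split=> -[dc de]; split; move: dc de; rewrite /derivable /derive E.
Qed.

Lemma is_derive_comp_scalar (R : realType) (V : normedModType R) (f : V -> R)
    (h : R -> R) (x v : V) (a b : R) :
  is_derive (f x) 1 h a -> is_derive x v f b -> is_derive x v (h \o f) (a * b).
Proof.
move=> hfx /is_derive_lineE fx; apply/is_derive_lineE.
by apply: is_derive1_comp fx; rewrite scale0r addr0.
Qed.

Lemma continuous_sumr (R : realType) (T : topologicalType) (I : Type)
    (r : seq I) (F : I -> T -> R) :
  (forall i, continuous (F i)) -> continuous (fun x => \sum_(i <- r) F i x).
Proof. by move=> cF; apply: continuous_big => //; exact: add_continuous. Qed.

Section log_sum_exp.
Context {R : realType} {n N : nat} (w : 'I_N.+1 -> 'rV[R]_n) (b : 'I_N.+1 -> R).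
Implicit Types (f g : 'rV[R]_n -> R) (j : 'I_N.+1) (i : 'I_n) (x y : 'rV[R]_n).

Definition exp_affine j x : R := expR (dot (w j) x + b j).

(** Indexing by ['I_N.+1] keeps the sum nonempty, hence positive, so that its logarithm is not a
    default value. *)
Definition sum_exp x : R := \sum_j exp_affine j x.

(** The factor [a] carries both the temperature and the multiplier of the separating function. *)
Definition log_sum_exp (a : R) x : R := a * ln (sum_exp x).

Lemma sum_exp_gt0 x : 0 < sum_exp x.
Proof.
rewrite /sum_exp big_ord_recl ltr_pwDl ?expR_gt0 //.
by apply: sumr_ge0 => j _; exact: expR_ge0.
Qed.

Lemma sum_exp_neq0 x : sum_exp x != 0. Proof. by rewrite gt_eqF ?sum_exp_gt0. Qed.

Lemma continuous_dot (v : 'rV[R]_n) : continuous (dot v).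
Proof.
apply: continuous_sumr => i x.
exact: cvgMl_tmp (@coord_continuous R 1 n 0 i x).
Qed.

Lemma continuous_exp_affine j : continuous (exp_affine j).
Proof.
move=> x; apply: (@continuous_comp _ _ _ (fun x => dot (w j) x + b j) expR).
  exact: cvgD (@continuous_dot (w j) x) (cvg_cst _).
exact: continuous_expR.
Qed.

Lemma continuous_sum_exp : continuous sum_exp.
Proof. exact: continuous_sumr continuous_exp_affine. Qed.

Lemma is_derive_exp_affine j i x :
  is_derive x (delta_mx 0 i) (exp_affine j) (w j 0 i * exp_affine j x).
Proof.
apply/is_derive_lineE.
have -> : (fun t : R => exp_affine j (x + t *: delta_mx 0 i)) =
    expR \o (fun t => w j 0 i * t + (dot (w j) x + b j)).
  apply/funext => t /=; rewrite /exp_affine dotDr dotZr dot_delta mulrC.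
  by rewrite addrAC addrC addrA.
rewrite mulrC; apply: is_derive1_comp.
  by rewrite mulr0 add0r; exact: is_derive_expR.
have dZ : is_derive (0 : R) (1 : R) (fun t : R => w j 0 i * t) (w j 0 i * 1).
  exact: (@is_deriveZ _ _ _ id).
have := is_deriveD dZ (is_derive_cst (dot (w j) x + b j) _ _).
by rewrite addr0 mulr1.
Qed.

Lemma is_derive_sum_exp i x :
  is_derive x (delta_mx 0 i) sum_exp (\sum_j w j 0 i * exp_affine j x).
Proof.
have -> : sum_exp = \sum_j exp_affine j by apply/funext => y; rewrite fct_sumE.
by apply: is_derive_sum => j; exact: is_derive_exp_affine.
Qed.

Lemma is_derive_log_sum_exp a i x :
  is_derive x (delta_mx 0 i) (log_sum_exp a)
    (a * ((sum_exp x)^-1 * \sum_j w j 0 i * exp_affine j x)).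
Proof.
apply: (@is_deriveZ _ _ _ (fun x => ln (sum_exp x))).
apply: is_derive_comp_scalar (is_derive_sum_exp i x).
exact/is_derive1_ln/sum_exp_gt0.
Qed.

(* The partial derivatives of [log_sum_exp] lie in this algebra, which is
   stable under partial derivatives; hence smoothness. *)
Inductive exp_rational : ('rV[R]_n -> R) -> Prop :=
| exp_rational_cst r : exp_rational (cst r)
| exp_rational_exp j : exp_rational (exp_affine j)
| exp_rational_inv : exp_rational (fun x => (sum_exp x)^-1)
| exp_rational_add f g : exp_rational f -> exp_rational g -> exp_rational (f + g)
| exp_rational_mul f g : exp_rational f -> exp_rational g -> exp_rational (f * g).

Lemma exp_rational_continuous f : exp_rational f -> continuous f.
Proof.
elim=> [r|j||{}f g _ cf _ cg|{}f g _ cf _ cg] x.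
- exact: (@cst_continuous _ _ r x).
- exact: (@continuous_exp_affine j x).
- exact: cvgV (sum_exp_neq0 x) (@continuous_sum_exp x).
- exact: cvgD (cf x) (cg x).
- exact: cvgM (cf x) (cg x).
Qed.

Lemma exp_rational_sum (F : 'I_N.+1 -> 'rV[R]_n -> R) :
  (forall j, exp_rational (F j)) -> exp_rational (\sum_j F j).
Proof.
move=> hF; apply: big_ind => [|f g|j _]; [|exact: exp_rational_add|exact: hF].
exact: exp_rational_cst.
Qed.

Lemma exp_rational_derive_sum i :
  exp_rational (fun x => \sum_j w j 0 i * exp_affine j x).
Proof.
have -> : (fun x => \sum_j w j 0 i * exp_affine j x) =
    \sum_j (cst (w j 0 i) * exp_affine j).
  by apply/funext => x; rewrite fct_sumE.
apply: exp_rational_sum => j.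
by apply: exp_rational_mul; [exact: exp_rational_cst | exact: exp_rational_exp].
Qed.

Lemma exp_rational_derive f i : exp_rational f ->
  exists g, exp_rational g /\ forall x, is_derive x (delta_mx 0 i) f (g x).
Proof.
elim=> [r|j||{}f g ef [f' [ef' df]] eg [g' [eg' dg]]|
        {}f g ef [f' [ef' df]] eg [g' [eg' dg]]].
- by exists (cst 0); split => [|x]; [exact: exp_rational_cst | exact: is_derive_cst].
- exists (cst (w j 0 i) * exp_affine j); split => [|x].
    by apply: exp_rational_mul; [exact: exp_rational_cst | exact: exp_rational_exp].
  exact: is_derive_exp_affine.
- exists (cst (-1) * ((fun x => (sum_exp x)^-1) * (fun x => (sum_exp x)^-1)) *
    (fun x => \sum_j w j 0 i * exp_affine j x)); split => [|x].
    apply: exp_rational_mul; last exact: exp_rational_derive_sum.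
    apply: exp_rational_mul; first exact: exp_rational_cst.
    by apply: exp_rational_mul; exact: exp_rational_inv.
  apply: (@is_derive_comp_scalar _ _ sum_exp GRing.inv); last exact: is_derive_sum_exp.
  apply: is_derive_eq; first by apply: is_deriveV; exact: sum_exp_neq0.
  by rewrite /GRing.scale /= mulr1 mulN1r expr2 invfM.
- exists (f' + g'); split => [|x]; first exact: exp_rational_add.
  exact: is_deriveD.
- exists (f * g' + g * f'); split => [|x].
    by apply: exp_rational_add; exact: exp_rational_mul.
  exact: is_deriveM.
Qed.

Lemma partial_log_sum_exp a i : partial i (log_sum_exp a) =
  fun x => a * ((sum_exp x)^-1 * \sum_j w j 0 i * exp_affine j x).
Proof. by apply/funext => x; case: (is_derive_log_sum_exp a i x). Qed.

Lemma smooth_log_sum_exp a : smooth (log_sum_exp a).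
Proof.
(* The function itself contains a logarithm and is not given by [exp_rational]; every nonempty
   iterated derivative is. *)
have iterE s : s = [::] \/ exp_rational (iter_partial s (log_sum_exp a)).
  elim: s => [|i s IH]; first by left.
  right; case: IH => [->|es].
    rewrite /= partial_log_sum_exp.
    apply: (exp_rational_mul (exp_rational_cst a)).
    exact: exp_rational_mul exp_rational_inv (exp_rational_derive_sum i).
  have [g [eg dg]] := exp_rational_derive i es.
  suff -> : iter_partial (i :: s) (log_sum_exp a) = g by [].
  by apply/funext => x; case: (dg x).
move=> s; case: (iterE s) => [->|es]; split.
- move=> x; suff h : {for x, continuous (fun x => ln (sum_exp x))} by exact: cvgMl_tmp h.
  apply: (@continuous_comp _ _ _ sum_exp (@ln R)).
    exact: continuous_sum_exp.
  exact/continuous_ln/sum_exp_gt0.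
- by move=> i x; case: (is_derive_log_sum_exp a i x).
- exact: exp_rational_continuous.
- by move=> i x; have [g [_ dg]] := exp_rational_derive i es; case: (dg x).
Qed.

Lemma convex_log_sum_exp a : 0 <= a ->
  convex_function (E := 'rV[R]_n) setT (log_sum_exp a).
Proof.
move=> a0 t x y _ _; rewrite convRE.
rewrite mulrCA [X in _ + X]mulrCA -mulrDr ler_wpM2l //.
rewrite -[X in _ <= X]expRK ler_ln ?posrE ?sum_exp_gt0 ?expR_gt0 //.
set s := t%:num; set s' := onem s.
have ss' : s + s' = 1 by rewrite /s' /onem addrC subrK.
set u := ln (sum_exp x); set v := ln (sum_exp y).
(* Dividing by the exponential of the right-hand side reduces the claim to a bound by 1. After [x]
   and [y] are normalized by [u] and [v] their sums equal 1, and convexity of [expR] applies to each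
   term. *)
rewrite -[leRHS]mul1r -ler_pdivrMr ?expR_gt0 // mulr_suml -ss'.
have -> : s + s' = s * (\sum_j expR (dot (w j) x + b j - u)) +
                   s' * (\sum_j expR (dot (w j) y + b j - v)).
  congr (_ + _); rewrite -[LHS]mulr1; congr (_ * _); symmetry;
    under eq_bigr do rewrite expRB lnK ?posrE ?sum_exp_gt0 //;
    by rewrite -mulr_suml mulfV ?sum_exp_neq0.
rewrite !mulr_sumr -big_split; apply: ler_sum => j _ /=.
have := convex_expR t (dot (w j) x + b j - u) (dot (w j) y + b j - v).
rewrite !convRE; apply: le_trans; rewrite -expRB ler_expR.
have -> : dot (w j) (conv t (x : convex_lmodType _) (y : convex_lmodType _)) =
    s * dot (w j) x + s' * dot (w j) y by rewrite -!dotZr -dotDr.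
rewrite -/s -/s'.
have : b j = s * b j + s' * b j by rewrite -mulrDl ss' mul1r.
lra.
Qed.

End log_sum_exp.

(** * Herbst's argument by doubling *)

Section bounded_random_variables.
Context {d : measure_display} {T : measurableType d} {R : realType}.
Variable P : probability T R.
Implicit Types (f g : T -> R).

(** A bound at every point makes all integrals below finite, so that expectations become the real
    numbers [mean]. *)
Definition bounded_rv f : Prop :=
  measurable_fun setT f /\ exists B, forall w, `|f w| <= B.

Lemma bounded_rv_integrable f : bounded_rv f -> P.-integrable setT (EFin \o f).
Proof.
move=> [mf [B fB]]; apply: measurable_bounded_integrable => //.
  by rewrite -ge0_fin_numE ?fin_num_measure.
exists B; split; first exact: num_real.
by move=> M BM w _ /=; rewrite (le_trans (fB w)) // ltW.
Qed.

Lemma bounded_rv_cst (c : R) : bounded_rv (cst c).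
Proof. by split => //; exists `|c|. Qed.

Lemma bounded_rvD f g : bounded_rv f -> bounded_rv g ->
  bounded_rv (fun w => f w + g w).
Proof.
move=> [mf [B fB]] [mg [C gC]]; split; first exact: measurable_funD.
by exists (B + C) => w; rewrite (le_trans (ler_normD _ _)) // lerD.
Qed.

Lemma bounded_rvM f g : bounded_rv f -> bounded_rv g ->
  bounded_rv (fun w => f w * g w).
Proof.
move=> [mf [B fB]] [mg [C gC]]; split; first exact: measurable_funM.
by exists (B * C) => w; rewrite normrM ler_pM.
Qed.

Lemma bounded_rv_expR f : bounded_rv f -> bounded_rv (fun w => expR (f w)).
Proof.
move=> [mf [B fB]]; split; first exact: measurableT_comp.
exists (expR B) => w; rewrite ger0_norm ?expR_ge0 // ler_expR.
exact: le_trans (ler_norm _) (fB w).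
Qed.

Lemma bounded_rvZ (c : R) f : bounded_rv f -> bounded_rv (fun w => c * f w).
Proof. exact: bounded_rvM (bounded_rv_cst c). Qed.

Lemma bounded_rv_indic (A : set T) : measurable A -> bounded_rv (\1_A).
Proof.
move=> mA; split; first exact: measurable_indic.
by exists 1 => w; rewrite indicE; case: (_ \in _); rewrite ?normr1 ?normr0 ?ler01.
Qed.

Definition mean f : R := \int[P]_w f w.

Lemma expectation_mean f : bounded_rv f -> 'E_P[f]%E = (mean f)%:E.
Proof.
move=> bf; rewrite unlock /mean /Rintegral fineK //.
exact/integrable_fin_num/bounded_rv_integrable.
Qed.

Lemma meanD f g : bounded_rv f -> bounded_rv g ->
  mean (fun w => f w + g w) = mean f + mean g.
Proof. by move=> bf bg; apply: RintegralD => //; exact: bounded_rv_integrable. Qed.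

Lemma meanZ (c : R) f : bounded_rv f -> mean (fun w => c * f w) = c * mean f.
Proof. by move=> bf; apply: RintegralZl => //; exact: bounded_rv_integrable. Qed.

Lemma mean_cst (c : R) : mean (cst c) = c.
Proof.
rewrite /mean Rintegral_cst // -[RHS]mulr1; congr (_ * _).
by have -> : fine (P setT) = fine 1%E by congr fine; exact: probability_setT.
Qed.

Lemma le_mean f g : bounded_rv f -> bounded_rv g -> (forall w, f w <= g w) ->
  mean f <= mean g.
Proof.
by move=> bf bg fg; apply: le_Rintegral => //; exact: bounded_rv_integrable.
Qed.

Lemma mean_indic (A : set T) : measurable A -> (mean \1_A)%:E = P A.
Proof.
move=> mA; rewrite -expectation_mean; last exact: bounded_rv_indic.
by rewrite unlock integral_indic // setIT.
Qed.

Lemma mean_expR_gt0 f : bounded_rv f -> 0 < mean (fun w => expR (f w)).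
Proof.
move=> bf; have [_ [B fB]] := bf.
rewrite (lt_le_trans (expR_gt0 (- B))) // -[leLHS]mean_cst.
apply: le_mean => [||w]; [exact: bounded_rv_cst|exact: bounded_rv_expR|].
rewrite ler_expR -[f w]opprK lerN2.
by rewrite (le_trans (ler_norm _)) // normrN.
Qed.

(* Testing the entropy of [exp g] against [g / 2 - ln E(exp (g / 2))] in its
   variational formula: [Ent Y >= E Y (ln (E Y) - 2 ln (E (sqrt Y)))]. *)
Lemma mean_expR_le_half g (eps : R) : bounded_rv g ->
  (entropy P (fun w => expR (g w)) <= (eps * mean (fun w => expR (g w)))%:E)%E ->
  mean (fun w => expR (g w)) <= expR eps * mean (fun w => expR (g w / 2)) ^+ 2.
Proof.
move=> bg; set Y := fun w => expR (g w); set a := mean Y.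
have bY : bounded_rv Y by exact: bounded_rv_expR.
have bYg : bounded_rv (fun w => Y w * g w) by exact: bounded_rvM.
have bh : bounded_rv (fun w => g w / 2).
  exact: bounded_rvM bg (bounded_rv_cst _).
set Z := fun w => expR (g w / 2).
have bZ : bounded_rv Z by exact: bounded_rv_expR.
have a0 : 0 < a by exact: mean_expR_gt0.
have z0 : 0 < mean Z by exact: mean_expR_gt0.
have -> : entropy P Y = (mean (fun w => Y w * g w) - a * ln a)%:E.
  rewrite /entropy (_ : (fun w => Y w * ln (Y w)) = (fun w => Y w * g w)).
    by rewrite !expectation_mean // ltry.
  by apply/funext => w; rewrite /Y expRK.
rewrite lee_fin => ent.
set b := ln (mean Z).
(* This integrates [1 - u <= expR (- u)], multiplied by [Y], for [u = g / 2 + b - ln a]. *)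
have key : 0 <= mean (fun w => 2^-1 * (Y w * g w) + ((b - ln a - 1) * Y w +
                               (a / mean Z) * Z w)).
  rewrite -[leLHS]mean_cst; apply: le_mean => [||w].
  - exact: bounded_rv_cst.
  - by apply: bounded_rvD; [|apply: bounded_rvD]; exact: bounded_rvZ.
  have -> : a / mean Z * Z w = Y w * expR (- (g w / 2 + b - ln a)).
    have -> : Y w = Z w * Z w by rewrite /Y /Z -expRD; congr expR; field.
    have -> : - (g w / 2 + b - ln a) = - (g w / 2) - b + ln a by ring.
    rewrite !expRD !expRN !lnK ?posrE // -/(Z w); field.
    by rewrite !gt_eqF // expR_gt0.
  have := expR_ge1Dx (- (g w / 2 + b - ln a)).
  move=> /(ler_wpM2l (expR_ge0 (g w))); rewrite -/(Y w) /=; lra.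
move: key; rewrite meanD; [|exact: bounded_rvZ|]; last first.
  by apply: bounded_rvD; exact: bounded_rvZ.
rewrite meanD; [|exact: bounded_rvZ|exact: bounded_rvZ].
rewrite !meanZ // divfK ?gt_eqF // -/a => key.
have : ln a <= eps + 2 * b.
  rewrite -(ler_pM2l a0); lra.
rewrite -ler_expR lnK ?posrE // => /le_trans; apply.
by rewrite expRD mulrDl mul1r expRD lnK ?posrE // expr2.
Qed.

(** With [x] the square root of [S], the mean of [expR (g / 2)] is at most [1 + 4/5 x], so
    [x <= 11/10 (1 + 4/5 x)]. Since [11/10 * 4/5 < 1], this bounds [x], by 10. *)
Lemma mean_expR_le_of_half g (eps : R) : bounded_rv g ->
  mean (\1_[set w | 0 < g w]) <= 3 / 5 ->
  expR eps <= (11 / 10) ^+ 2 ->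
  mean (fun w => expR (g w)) <= expR eps * mean (fun w => expR (g w / 2)) ^+ 2 ->
  mean (fun w => expR (g w)) <= 100.
Proof.
move=> bg g35 eps11; set S := mean _ => S_le.
have S0 : 0 < S by exact: mean_expR_gt0.
pose x := Num.sqrt S.
have x0 : 0 < x by rewrite sqrtr_gt0.
have xS : x ^+ 2 = S by rewrite sqr_sqrtr // ltW.
have bY : bounded_rv (fun w => expR (g w)) by exact: bounded_rv_expR.
have bh : bounded_rv (fun w => g w / 2).
  exact: bounded_rvM bg (bounded_rv_cst _).
have bI : bounded_rv (\1_[set w | 0 < g w]).
  apply: bounded_rv_indic; rewrite -[X in measurable X]setTI.
  have -> : [set w | 0 < g w] = g @^-1` `]0, +oo[.
    by apply/seteqP; split => w /=; rewrite in_itv /= andbT.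
  by apply: bg.1 => //; exact: measurable_itv.
have z_le : mean (fun w => expR (g w / 2)) <= 1 + 4 / 5 * x.
  (* Pointwise, [expR (g / 2)] is at most 1 where [g <= 0]; elsewhere the arithmetic-geometric mean
     inequality bounds it by [(expR g / x + x) / 2]. The coefficient of [x] is then [1/2 + 3/10]. *)
  apply: (@le_trans _ _ (mean (fun w => cst 1 w + ((2 * x)^-1 * expR (g w) +
             x / 2 * \1_[set w | 0 < g w] w)))).
    apply: le_mean => [||w].
    - exact: bounded_rv_expR.
    - apply: bounded_rvD; first exact: bounded_rv_cst.
      by apply: bounded_rvD; exact: bounded_rvZ.
    set y := expR (g w / 2).
    have -> : expR (g w) = y ^+ 2 by rewrite expr2 -expRD; congr expR; field.
    rewrite indicE /=; have [g0|g0] := ltP 0 (g w).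
      rewrite mem_set //= mulr1.
      have -> : (2 * x)^-1 * y ^+ 2 + x / 2 = y + (2 * x)^-1 * (y - x) ^+ 2.
        by field; rewrite gt_eqF.
      rewrite addrCA lerDl addr_ge0 // mulr_ge0 ?sqr_ge0 // invr_ge0.
      by rewrite mulr_ge0 // ltW.
    rewrite memNset /= ?mulr0 ?addr0; last by rewrite ltNge g0.
    rewrite (@le_trans _ _ 1) //; first by rewrite /y -[leRHS]expR0 ler_expR; lra.
    by rewrite lerDl mulr_ge0 ?sqr_ge0 // invr_ge0 mulr_ge0 // ltW.
  rewrite meanD; [|exact: bounded_rv_cst|]; last first.
    by apply: bounded_rvD; exact: bounded_rvZ.
  rewrite meanD; [|exact: bounded_rvZ|exact: bounded_rvZ].
  rewrite mean_cst !meanZ // -/S -xS lerD2l.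
  have -> : (2 * x)^-1 * x ^+ 2 = x / 2 by field; rewrite gt_eqF.
  by have := ler_wpM2l (ltW x0) g35; lra.
have z0 : 0 <= mean (fun w => expR (g w / 2)) by exact/ltW/mean_expR_gt0.
have : x ^+ 2 <= (11 / 10 * (1 + 4 / 5 * x)) ^+ 2.
  rewrite xS (le_trans S_le) // exprMn ler_pM ?expR_ge0 ?sqr_ge0 //.
  by rewrite lerXn2r ?nnegrE // (le_trans z0).
have y0 : 0 <= 11 / 10 * (1 + 4 / 5 * x) by lra.
rewrite ler_sqr ?nnegrE ?(ltW x0) // => x10.
have {}x10 : x <= 10 by lra.
by rewrite -xS; nra.
Qed.

(** Each doubling squares the mean and adds [C (2^k s)^2 / r] to the exponent. The term
    [2 C (2^k s)^2 / r] solves this recursion exactly: [2 * 2 + 4 = 2 * 4]. *)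
Lemma mean_expR_doubling f (C r s : R) (k : nat) : bounded_rv f ->
  0 < C -> 0 < r -> 0 < s ->
  mean (\1_[set w | 0 < f w]) <= 3 / 5 ->
  expR (C * s ^+ 2 / r) <= (11 / 10) ^+ 2 ->
  (forall j, (j <= k)%N ->
    (entropy P (fun w => expR (2 ^+ j * s * f w)) <=
     (C * (2 ^+ j * s) ^+ 2 / r * mean (fun w => expR (2 ^+ j * s * f w)))%:E)%E) ->
  mean (fun w => expR (2 ^+ k * s * f w)) <=
    expR (2 ^+ k * ln 100 + 2 * C * (2 ^+ k * s) ^+ 2 / r).
Proof.
move=> bf C0 r0 s0 f35 eps11; elim: k => [|k IH] ent.
  have bg : bounded_rv (fun w => 2 ^+ 0 * s * f w) by exact: bounded_rvZ.
  have -> : 2 ^+ 0 * ln 100 + 2 * C * (2 ^+ 0 * s) ^+ 2 / r =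
      ln 100 + 2 * (C * s ^+ 2 / r) by rewrite expr0; field; rewrite gt_eqF.
  apply: (@le_trans _ _ 100).
    apply: mean_expR_le_of_half (mean_expR_le_half bg (ent 0 _)) => //.
      rewrite (_ : [set w | _] = [set w | 0 < f w]) //.
      by apply/seteqP; split => w /=; rewrite mul1r pmulr_rgt0.
    by rewrite mul1r.
  rewrite expRD lnK ?posrE // ler_peMr // -expR0 ler_expR.
  by rewrite mulr_ge0 // divr_ge0 ?mulr_ge0 ?sqr_ge0 ?ltW.
have bg : bounded_rv (fun w => 2 ^+ k.+1 * s * f w) by exact: bounded_rvZ.
apply: (le_trans (mean_expR_le_half bg (ent k.+1 _))) => //.
have -> : (fun w => expR (2 ^+ k.+1 * s * f w / 2)) =
    (fun w => expR (2 ^+ k * s * f w)).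
  by apply/funext => w; congr expR; rewrite exprS; field.
have {}IH := IH (fun j jk => ent j (leqW jk)).
have : mean (fun w => expR (2 ^+ k * s * f w)) ^+ 2 <=
   expR (2 ^+ k * ln 100 + 2 * C * (2 ^+ k * s) ^+ 2 / r) ^+ 2.
  rewrite lerXn2r ?nnegrE ?expR_ge0 //.
  by apply/ltW/mean_expR_gt0; exact: bounded_rvZ.
move=> /(ler_wpM2l (expR_ge0 (C * (2 ^+ k.+1 * s) ^+ 2 / r))) /le_trans; apply.
rewrite [X in _ * X]expr2 -!expRD ler_expR [2 ^+ k.+1]exprS le_eqVlt; apply/orP; left; apply/eqP.
by field; rewrite gt_eqF.
Qed.

Lemma mean_expR_markov f (t : R) (y : R) : bounded_rv f -> 0 < t ->
  measurable [set w | y <= f w] ->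
  (P [set w | (y <= f w)%R] <= (expR (- (t * y)) * mean (fun w => expR (t * f w)))%:E)%E.
Proof.
move=> bf t0 mA; rewrite -mean_indic // lee_fin.
have bI := bounded_rv_indic mA.
have be : bounded_rv (fun w => expR (t * f w)) by exact/bounded_rv_expR/bounded_rvZ.
rewrite -meanZ //; apply: le_mean => // [|w]; first exact: bounded_rvZ.
rewrite -expRD indicE; have [yf|yf] := leP y (f w).
  by rewrite mem_set //= -expR0 ler_expR addrC -mulrBr mulr_ge0 ?subr_ge0 // ltW.
by rewrite memNset ?expR_ge0 //=; rewrite leNgt yf.
Qed.

End bounded_random_variables.

(** * Clipped random variables *)

(** The integral of a nonnegative function is a supremum over simple functions below it. This form
    also covers integrands whose measurability is not at hand, such as the gradient term of the
    log-Sobolev inequality. *)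
Lemma le_ge0_integral (d : measure_display) (T : measurableType d)
    (R : realType) (mu : measure T R) (D : set T) (f g : T -> \bar R) :
  (forall x, D x -> 0 <= f x <= g x)%E ->
  (\int[mu]_(x in D) f x <= \int[mu]_(x in D) g x)%E.
Proof.
move=> fg.
have f0 x : D x -> (0 <= f x)%E by move=> /fg/andP[].
have g0 x : D x -> (0 <= g x)%E by move=> /fg/andP[]; exact: le_trans.
rewrite !ge0_integralE //.
apply: le_ereal_sup => _ [h /= hf <-]; exists h => // x.
apply: (le_trans (hf x)); rewrite /patch; case: ifPn => // /set_mem Dx.
by have /andP[] := fg _ Dx.
Qed.

Section clip.
Context {d : measure_display} {T : measurableType d} {R : realType}.
Variable P : probability T R.

Definition clip (M x : R) : R := Num.max (- M) (Num.min x M).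

Lemma measurable_clip M : measurable_fun setT (clip M).
Proof.
apply: measurable_maxr => //; exact: measurable_minr.
Qed.

Lemma clip_id M x : `|x| <= M -> clip M x = x.
Proof. by rewrite ler_norml => /andP[? ?]; rewrite /clip min_l // max_r. Qed.

Lemma norm_clip_le M x : 0 <= M -> `|clip M x| <= M.
Proof.
move=> M0; rewrite ler_norml /clip le_max lexx ge_max ge_min lexx orbT andbT.
by rewrite (le_trans _ M0) // oppr_le0.
Qed.

Lemma clip_ge M x y : - M < y -> (y <= clip M x) = (y <= x) && (y <= M).
Proof. by move=> My; rewrite /clip le_max le_min leNgt My. Qed.

Lemma clip_le M x y : y < M -> (clip M x <= y) = (x <= y) && (- M <= y).
Proof. by move=> My; rewrite /clip ge_max ge_min (leNgt M) My orbF andbC. Qed.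

Definition clip_rv M (X : {RV P >-> R}) : T -> R := clip M \o X.

Lemma measurable_clip_rv M X : measurable_fun setT (clip_rv M X).
Proof. exact: measurableT_comp (measurable_clip M) _. Qed.

HB.instance Definition _ M X :=
  isMeasurableFun.Build _ _ _ _ (clip_rv M X) (measurable_clip_rv M X).

(** Up to the level [M] the right-hand side is unchanged and the integral can only decrease; beyond
    [M] both vanish. *)
Lemma tail_class_truncate (beta m s M : R) (mu mu' : probability R R) :
  0 < m -> 0 <= s -> m <= M ->
  (forall x, m <= x ->
    mu' `[x, +oo[%classic = if x <= M then mu `[x, +oo[%classic else 0%E) ->
  (forall x, x <= - m ->
    mu' `]-oo, x]%classic = if - M <= x then mu `]-oo, x]%classic else 0%E) ->
  tail_class beta m s mu -> tail_class beta m s mu'.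
Proof.
move=> m0 s0 mM pE nE [mup mum]; split => x mx.
  rewrite pE //; have [xM|xM] := leP x M.
    apply: le_trans (mup x mx); apply: le_ge0_integral => y /= [_].
    rewrite in_itv /= andbT => my.
    rewrite mule_ge0 ?lee_fin ?powR_ge0 //= lee_wpmul2l ?lee_fin ?powR_ge0 //.
    by rewrite pE //; case: ifP.
  rewrite mule0 /nu_plus integral0_eq // => y /= [].
  rewrite !in_itv /= !andbT => xy my; rewrite pE // leNgt (lt_le_trans xM) //=.
  by rewrite mule0.
rewrite nE //; have [xM|xM] := leP (- M) x.
  apply: le_trans (mum x mx); apply: le_ge0_integral => y /= [_].
  rewrite in_itv /= => my.
  rewrite mule_ge0 ?lee_fin ?powR_ge0 //= lee_wpmul2l ?lee_fin ?powR_ge0 //.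
  by rewrite nE //; case: ifP.
rewrite mule0 /nu_minus integral0_eq // => y /= [].
rewrite !in_itv /= => xy my; rewrite nE // leNgt (le_lt_trans xy) //=.
by rewrite mule0.
Qed.

Lemma tail_class_clip_rv (beta m s M : R) (X : {RV P >-> R}) :
  0 < m -> 0 <= s -> m <= M ->
  tail_class beta m s (distribution P X) ->
  tail_class beta m s (distribution P (clip_rv M X)).
Proof.
move=> m0 s0 mM.
have M0 : 0 < M := lt_le_trans m0 mM.
apply: (tail_class_truncate m0 s0 mM) => x mx.
  have Mx : - M < x by rewrite (lt_le_trans _ mx) // (lt_trans _ m0) // oppr_lt0.
  rewrite /= /distribution /pushforward; have [xM|xM] := leP x M.
    congr (P _); apply/seteqP; split => w /=;
    by rewrite !in_itv /= !andbT /clip_rv /= clip_ge // xM andbT.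
  rewrite (_ : _ @^-1` _ = set0) ?measure0 //; apply/seteqP; split => w //=.
  by rewrite in_itv /= andbT /clip_rv /= clip_ge // (leNgt x M) xM andbF.
have xM' : x < M by rewrite (le_lt_trans mx) // (lt_trans _ M0) // oppr_lt0.
rewrite /= /distribution /pushforward; have [xM|xM] := leP (- M) x.
  congr (P _); apply/seteqP; split => w /=;
  by rewrite !in_itv /= /clip_rv /= clip_le // xM andbT.
rewrite (_ : _ @^-1` _ = set0) ?measure0 //; apply/seteqP; split => w //=.
by rewrite in_itv /= /clip_rv /= clip_le // (leNgt (- M)) xM andbF.
Qed.

Lemma independent_clip_rv n (M : R) (X : 'I_n -> {RV P >-> R}) :
  independent X ->
  independent (fun i => clip_rv M (X i) : {RV P >-> R}).
Proof.
move=> iX J B mB; apply: (iX J (fun i => clip M @^-1` B i)) => i.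
by rewrite -[X in measurable X]setTI; exact: measurable_clip.
Qed.

Lemma measure_gt_small (V : T -> R) (M0 e : R) : measurable_fun setT V -> 0 < e ->
  exists2 M, M0 <= M & (P [set w | (M < V w)%R] <= e%:E)%E.
Proof.
move=> mV e0; pose F (k : nat) := [set w | (M0 + k%:R < V w)%R].
have mF k : measurable (F k).
  rewrite -[X in measurable X]setTI (_ : F k = V @^-1` `]M0 + k%:R, +oo[).
    by apply: mV => //; exact: measurable_itv.
  by apply/seteqP; split => w /=; rewrite in_itv /= andbT.
have F0 : \bigcap_k F k = set0.
  (* A point [w] leaves [F k] as soon as [k] exceeds [V w - M0]. *)
  apply/seteqP; split => w //= /(_ (Num.truncn (V w - M0)).+1 I).
  rewrite /F /= -ltrBrDl ltNge => /negP; apply.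
  exact/ltW/truncnS_gt.
have : P (F k) @[k --> \oo] --> P (\bigcap_k F k).
  apply: nonincreasing_cvg_mu => //.
  - by rewrite -ge0_fin_numE ?fin_num_measure.
  - exact: bigcap_measurable.
  - move=> k l kl; rewrite subsetEset => w; rewrite /F /=; apply: le_lt_trans.
    by rewrite lerD2l ler_nat.
rewrite F0 measure0 => /fine_cvgP[_ /cvgr_lt /(_ e e0)] [k _ /(_ k (leqnn k))] /=.
move=> Fk; exists (M0 + k%:R); first by rewrite lerDl.
have := fin_num_measure P (F k) (mF k) => /fineK <-.
by rewrite lee_fin ltW.
Qed.

End clip.

(** * Smooth separation from a convex set *)

Section smooth_separator.
Context {R : realType} {n : nat}.
Implicit Types (A K S : set 'rV[R]_n) (x y v : 'rV[R]_n) (M : R).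

(** The cube is cut into cells of side [e]. The representative of a cell is taken in [S] itself,
    because separating functionals exist only at points of [S]. *)
Lemma finite_net S M (e : R) : 0 < e -> (forall x, S x -> forall i, `|x 0 i| <= M) ->
  exists s : seq 'rV[R]_n, (forall y, y \in s -> S y) /\
    forall x, S x -> exists2 y, y \in s & forall i, `|x 0 i - y 0 i| <= e.
Proof.
move=> e0 SM.
(* On [S] the cell indices are at most [L], so [inord] never returns its default there. *)
pose L := Num.truncn (2 * M / e).
pose cell x : {ffun 'I_n -> 'I_L.+1} := [ffun i => inord (Num.truncn ((x 0 i + M) / e))].
pose Sc c := [set x | S x /\ cell x = c].
exists [seq xget 0 (Sc c) | c <- enum {ffun 'I_n -> 'I_L.+1} & `[< Sc c !=set0 >]].
split => [y /mapP[c]|x Sx].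
  rewrite mem_filter => /andP[/asboolP[x cx] _] ->.
  by have [] := xgetI 0 cx.
have xc : Sc (cell x) x by [].
exists (xget 0 (Sc (cell x))).
  by apply/map_f; rewrite mem_filter mem_enum andbT; apply/asboolP; exists x.
have [Sy] := xgetI 0 xc; set y := xget _ _ => yx i.
have cellE z : S z -> cell z i = Num.truncn ((z 0 i + M) / e) :> nat.
  move=> Sz; rewrite ffunE inordK // ltnS le_truncn //.
  rewrite ler_wpM2r ?invr_ge0 ?(ltW e0) //.
  by have := SM z Sz i; rewrite ler_norml => /andP[_]; lra.
have itv z : S z -> (cell z i : nat)%:R * e <= z 0 i + M < ((cell z i : nat).+1)%:R * e.
  move=> Sz; rewrite -ler_pdivlMr // -ltr_pdivrMr // cellE // truncn_itv //.
  rewrite divr_ge0 ?(ltW e0) //.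
  by have := SM z Sz i; rewrite ler_norml => /andP[]; lra.
have := itv x Sx; have := itv y Sy; rewrite yx -natr1 mulrDl mul1r ler_norml.
by move=> /andP[? ?] /andP[? ?]; apply/andP; split; lra.
Qed.

(** The polar inequality is tested on small multiples of plus and minus each basis vector. *)
Lemma polar_bounded K : absorbing K ->
  exists2 B, 0 <= B & forall v, (forall k, K k -> dot v k <= 1) ->
    forall i, `|v 0 i| <= B.
Proof.
move=> aK.
have bnd i : exists2 B, 0 <= B & forall v, (forall k, K k -> dot v k <= 1) -> `|v 0 i| <= B.
  have [t t0 Kt] := aK (delta_mx 0 i); have [u u0 Ku] := aK (- delta_mx 0 i).
  have t'0 : 0 <= t^-1 by rewrite invr_ge0 ltW.
  have u'0 : 0 <= u^-1 by rewrite invr_ge0 ltW.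
  exists (t^-1 + u^-1); first exact: addr_ge0.
  move=> v vK; have := vK _ Kt; have := vK _ Ku.
  rewrite scalerN -scaleNr !dotZr dot_delta mulNr -mulrN.
  rewrite -ler_pdivlMl // -ler_pdivlMl // !mulr1 => vu vt.
  by rewrite ler_norml; apply/andP; split; lra.
have /choice[B HB] : forall i, exists B, 0 <= B /\
    forall v, (forall k, K k -> dot v k <= 1) -> `|v 0 i| <= B.
  by move=> i; have [B ? ?] := bnd i; exists B.
exists (\sum_i B i); first by apply: sumr_ge0 => i _; case: (HB i).
move=> v vK i; rewrite (le_trans ((HB i).2 v vK)) // (bigD1 i) //= lerDl.
by apply: sumr_ge0 => j _; case: (HB j).
Qed.

Lemma finite_separation A K M : cvx A -> A !=set0 -> cvx K -> K 0 -> absorbing K ->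
  exists (N : nat) (v : 'I_N.+1 -> 'rV[R]_n) (c : 'I_N.+1 -> R),
  [/\ forall j a, A a -> dot (v j) a <= c j,
      forall j k, K k -> dot (v j) k <= 1 &
      forall x, (forall i, `|x 0 i| <= M) -> ~ minkowski_sum A K x ->
        exists j, c j + 7 / 8 <= dot (v j) x].
Proof.
move=> cA A0 cK K0 aK; have [B B0 HB] := polar_bounded aK.
pose S := [set x : 'rV[R]_n | (forall i, `|x 0 i| <= M) /\ ~ minkowski_sum A K x].
(* Chosen so that [n * B * e <= 1/8]: replacing a point by its neighbour in the net lowers the
   margin from 1 to 7/8. *)
pose e := (8 * (B + 1) * n.+1%:R)^-1.
have e0 : 0 < e by rewrite invr_gt0 !mulr_gt0 // ltr_wpDl.
have [|s [sS snet]] := @finite_net S M e e0; first by move=> x [].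
pose good x (vc : 'rV[R]_n * R) :=
  [/\ forall a, A a -> dot vc.1 a <= vc.2,
      forall k, K k -> dot vc.1 k <= 1 & S x -> vc.2 + 1 <= dot vc.1 x].
have dot0 y : dot 0 y = 0 :> R by apply: big1 => i _; rewrite mxE mul0r.
have good0 x : ~ S x -> good x (0, 0).
  by move=> Sx; split => //= *; rewrite dot0 ?ler01.
have /choice[F HF] : forall x, exists vc, good x vc.
  move=> x; have [Sx|Sx] := pselect (S x); last by exists (0, 0); exact: good0.
  have [v [c [? ? ?]]] := separate_minkowski_sum cA A0 cK K0 aK Sx.2.
  by exists (v, c).
(* The extra last index gets the default [(0, 0)], which satisfies both bounds, so the family is
   nonempty even for an empty net. *)
pose f (j : 'I_(size s).+1) := nth (0, 0) [seq F x | x <- s] j.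
have fP j : (forall a, A a -> dot (f j).1 a <= (f j).2) /\
    forall k, K k -> dot (f j).1 k <= 1.
  have [js|js] := ltnP j (size s).
    by rewrite /f (nth_map 0) //; case: (HF (nth 0 s j)).
  by rewrite /f nth_default ?size_map //=; split => *; rewrite dot0 ?ler01.
exists (size s), (fun j => (f j).1), (fun j => (f j).2); split.
- by move=> j; case: (fP j).
- by move=> j; case: (fP j).
move=> x xM xAK; have [y ys yx] := snet x (conj xM xAK).
have js : (index y s < (size s).+1)%N by rewrite ltnS index_size.
exists (Ordinal js); have [_ fK] := fP (Ordinal js).
have := HB _ fK; have -> : f (Ordinal js) = F y.
  by rewrite /f /= (nth_map 0) ?index_mem // nth_index.
move=> fB; have [_ _ /(_ (sS _ ys)) Fy] := HF y.
have : `|dot (F y).1 (x - y)| <= 1 / 8.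
  apply: (@le_trans _ _ (\sum_(i < n) B * e)).
    apply: (le_trans (ler_norm_sum _ _ _)); apply: ler_sum => i _.
    by rewrite normrM ler_pM // !mxE.
  rewrite sumr_const card_ord -[X in X <= _]mulr_natr /e mulrAC.
  rewrite ler_pdivrMr; last by rewrite !mulr_gt0 // ltr_wpDl.
  have n0 : 0 <= n%:R :> R by [].
  by rewrite -[n.+1%:R]natr1; nra.
by rewrite dotBr ler_norml => /andP[+ _]; lra.
Qed.

End smooth_separator.

Lemma bounded_rv_log_sum_exp (d : measure_display) (T : measurableType d)
    (R : realType) (P : probability T R) (n N : nat) (w : 'I_N.+1 -> 'rV[R]_n)
    (b : 'I_N.+1 -> R) (a : R) (X : 'I_n -> {RV P >-> R}) :
  (forall i, bounded_rv (X i)) ->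
  bounded_rv (fun t => log_sum_exp w b a (rvec X t)).
Proof.
move=> bX.
have bsum (I : finType) (F : I -> T -> R) :
    (forall i, bounded_rv (F i)) -> bounded_rv (fun t => \sum_i F i t).
  move=> bF; elim: (index_enum I) => [|i s IH].
    by under eq_fun do rewrite big_nil; exact: bounded_rv_cst.
  by under eq_fun do rewrite big_cons; exact: bounded_rvD.
have baff j : bounded_rv (fun t => dot (w j) (rvec X t) + b j).
  apply: bounded_rvD; last exact: bounded_rv_cst.
  by apply: bsum => i; under eq_fun do rewrite mxE; exact: bounded_rvZ.
have [mS [B SB]] : bounded_rv (fun t => sum_exp w b (rvec X t)).
  by apply: bsum => j; exact: bounded_rv_expR.
apply: bounded_rvZ; split.
  exact: measurableT_comp (@measurable_ln R) mS.
(* The lower bound for the logarithm comes from the single term of index 0. *)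
have [_ [B0 HB0]] := baff ord0.
exists (Num.max B0 (ln B)) => t; rewrite ler_norml; apply/andP; split.
  rewrite lerNl le_max lerNl; apply/orP; left.
  rewrite -[leLHS]expRK ler_ln ?posrE ?expR_gt0 ?sum_exp_gt0 //.
  apply: (@le_trans _ _ (exp_affine w b ord0 (rvec X t))).
    rewrite ler_expR; have := HB0 t; rewrite ler_norml => /andP[+ _].
    exact.
  rewrite /sum_exp big_ord_recl lerDl.
  by apply: sumr_ge0 => j _; exact: expR_ge0.
rewrite le_max; apply/orP; right.
have Sle : sum_exp w b (rvec X t) <= B by exact: le_trans (ler_norm _) (SB t).
by rewrite ler_ln ?posrE ?sum_exp_gt0 // (lt_le_trans (sum_exp_gt0 w b (rvec X t))).
Qed.

Section separator.
Context {R : realType} {n : nat}.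
Implicit Types (A K : set 'rV[R]_n) (x v : 'rV[R]_n) (M : R).

(** The gradient of log-sum-exp is a convex combination of the [v j], hence in the polar of [K].
    Dividing by [N.+1] makes the sum at most 1 on [A]. *)
Lemma smooth_separator A K M : cvx A -> A !=set0 -> cvx K -> K 0 -> absorbing K ->
  exists h : 'rV[R]_n -> R,
  [/\ forall l : R, 0 <= l ->
        [/\ smooth (fun x => l * h x),
            convex_function (E := 'rV[R]_n) setT (fun x => l * h x) &
            forall x, exists G, (forall k, K k -> dot G k <= 1) /\
              grad (fun x => l * h x) x = l *: G],
      forall a, A a -> h a <= 0,
      forall x, (forall i, `|x 0 i| <= M) -> ~ minkowski_sum A K x -> 3 / 4 <= h x &
      forall (d : measure_display) (T : measurableType d) (P : probability T R)
        (X : 'I_n -> {RV P >-> R}), (forall i, bounded_rv (X i)) ->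
        bounded_rv (fun t => h (rvec X t)) ].
Proof.
move=> cA A0 cK K0 aK.
have [N [v [c [Av Kv sep]]]] := finite_separation M cA A0 cK K0 aK.
(* The division by [N.+1] costs [ln N.+1%:R / kappa <= 1/8], which lowers 7/8 to 3/4; the summand 1
   keeps [kappa] positive when [N = 0]. *)
pose kappa : R := 8 * (ln N.+1%:R + 1).
have lnN0 : 0 <= ln N.+1%:R :> R by rewrite ln_ge0 // ler1n.
have k0 : 0 < kappa by rewrite mulr_gt0 // ltr_wpDl.
have kN0 : kappa != 0 by rewrite gt_eqF.
pose w j := kappa *: v j; pose b j := - (kappa * c j) - ln N.+1%:R.
have expE j x : exp_affine w b j x =
    expR (kappa * (dot (v j) x - c j)) / N.+1%:R.
  rewrite /exp_affine /w /b dotZl addrA -mulrBr expRD expRN lnK //.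
  by rewrite posrE ltr0n.
exists (log_sum_exp w b kappa^-1); split.
- move=> l l0.
  have -> : (fun x => l * log_sum_exp w b kappa^-1 x) = log_sum_exp w b (l / kappa).
    by apply/funext => x; rewrite /log_sum_exp mulrA.
  split; first exact: smooth_log_sum_exp.
    by apply: convex_log_sum_exp; rewrite divr_ge0 // ltW.
  move=> x; pose S := sum_exp w b x; pose p j := exp_affine w b j x / S.
  have S0 : 0 < S by exact: sum_exp_gt0.
  exists (\sum_j p j *: v j); split => [k Kk|].
    have -> : dot (\sum_j p j *: v j) k = \sum_j p j * dot (v j) k.
      rewrite /dot; under [RHS]eq_bigr do rewrite mulr_sumr.
      rewrite exchange_big; apply: eq_bigr => i _ /=; rewrite summxE mulr_suml.
      by apply: eq_bigr => j _; rewrite !mxE mulrA.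
    rewrite -[leRHS](mulfV (lt0r_neq0 S0)) mulr_suml.
    apply: ler_sum => j _; rewrite -[leRHS]mulr1 ler_wpM2l ?Kv //.
    by rewrite divr_ge0 ?expR_ge0 // ltW.
  apply/rowP => i; rewrite !mxE partial_log_sum_exp summxE -mulrA; congr (_ * _).
  rewrite !mulr_sumr; apply: eq_bigr => j _; rewrite !mxE /p /S.
  by field; rewrite kN0 sum_exp_neq0.
- move=> a Aa; rewrite /log_sum_exp pmulr_rle0 ?invr_gt0 // ln_le0 //.
  apply: (@le_trans _ _ (\sum_(j < N.+1) N.+1%:R^-1)).
    apply: ler_sum => j _; rewrite expE ler_piMl ?invr_ge0 //.
    rewrite -[leRHS]expR0 ler_expR pmulr_rle0 // subr_le0; exact: Av.
  by rewrite sumr_const card_ord -[leLHS]mulr_natr mulVf // pnatr_eq0.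
- move=> x xM xAK; have [j jx] := sep x xM xAK.
  rewrite /log_sum_exp ler_pdivlMl //.
  apply: (@le_trans _ _ (ln (exp_affine w b j x))).
    rewrite /exp_affine expRK /w /b dotZl.
    have := ler_wpM2l (ltW k0) jx; rewrite mulrDr.
    have : ln N.+1%:R <= kappa / 8 by rewrite /kappa; lra.
    lra.
  rewrite ler_ln ?posrE ?expR_gt0 ?sum_exp_gt0 // /sum_exp (bigD1 j) //= lerDl.
  by apply: sumr_ge0 => i _; exact: expR_ge0.
- by move=> d T P X bX; exact: bounded_rv_log_sum_exp.
Qed.

End separator.

(** * The enlarging body, its polar and the gradient term *)

Definition enlargement (R : realType) (n : nat) (beta r : R) : set 'rV[R]_n :=
  minkowski_sum (dilate (r `^ 2^-1) (lp_ball n 2))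
                (dilate (r `^ (1 + beta)^-1) (lp_ball n (1 + beta))).
Arguments enlargement {R} n beta r.

Section enlargement.
Context {R : realType} {n : nat}.
Variables (beta r : R).
Hypotheses (beta0 : 0 <= beta) (r0 : 0 < r).

Let q0 : 0 < 1 + beta. Proof. by rewrite ltr_wpDr. Qed.

Lemma cvx_enlargement : cvx (enlargement n beta r).
Proof.
apply: cvx_minkowski_sum; apply: cvx_dilate; apply: cvx_lp_ball; first by rewrite ler1n.
by rewrite lerDl.
Qed.

Lemma enlargement_l (x : 'rV[R]_n) : lp_ball n 2 x ->
  enlargement n beta r (r `^ 2^-1 *: x).
Proof.
move=> xB; exists (r `^ 2^-1 *: x); first by exists x.
exists 0; last by rewrite addr0.
by exists 0; [exact: lp_ball0 | exact: scaler0].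
Qed.

Lemma enlargement_r (x : 'rV[R]_n) : lp_ball n (1 + beta) x ->
  enlargement n beta r (r `^ (1 + beta)^-1 *: x).
Proof.
move=> xB; exists 0; first by exists 0; [exact: lp_ball0 | exact: scaler0].
by exists (r `^ (1 + beta)^-1 *: x); [exists x | rewrite add0r].
Qed.

Lemma enlargement0 : enlargement n beta r 0.
Proof. by have := enlargement_l (lp_ball0 _); rewrite scaler0; apply. Qed.

Lemma absorbing_enlargement : absorbing (enlargement n beta r).
Proof.
have r20 : 0 < r `^ 2^-1 by exact: powR_gt0.
have aB : absorbing (lp_ball n (2 : R)) by exact: absorbing_lp_ball.
move=> x; have [t t0 [y yB yx]] := absorbing_dilate r20 aB x.
exists t => //; rewrite -yx; exact: enlargement_l.
Qed.

Lemma polar_enlargement_l2 (G : 'rV[R]_n) :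
  (forall k, enlargement n beta r k -> dot G k <= 1) -> r * lp_sum 2 G <= 1.
Proof.
move=> GK; have := @polar_lp_ball R n 2 2 (r `^ 2^-1) G.
rewrite -powRrM mulVf ?powRr1 ?(ltW r0) //; apply => //.
- by ring.
- exact: powR_ge0.
- by move=> y yB; apply: GK; exact: enlargement_l.
Qed.

(** The exponents [(beta + 1) / beta] and [1 + beta] are conjugate, and the radius [r^(1/(1+beta))]
    raised to the former is [r^(1/beta)]. *)
Lemma polar_enlargement_lp (G : 'rV[R]_n) : 0 < beta ->
  (forall k, enlargement n beta r k -> dot G k <= 1) ->
  r `^ beta^-1 * lp_sum ((beta + 1) / beta) G <= 1.
Proof.
move=> b0 GK; have bN0 : beta != 0 by rewrite gt_eqF.
have := @polar_lp_ball R n ((beta + 1) / beta) (1 + beta) (r `^ (1 + beta)^-1) G.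
rewrite -powRrM.
have -> : (1 + beta)^-1 * ((beta + 1) / beta) = beta^-1.
  by field; rewrite bN0 gt_eqF.
apply => //.
- by rewrite divr_gt0 // addrC.
- by field.
- exact: powR_ge0.
- by move=> y yB; apply: GK; exact: enlargement_r.
Qed.

Lemma polar_enlargement_sup (G : 'rV[R]_n) : beta = 0 ->
  (forall k, enlargement n beta r k -> dot G k <= 1) -> forall i, r * `|G 0 i| <= 1.
Proof.
move=> b0 GK; apply: polar_l1_ball (ltW r0) _ => y yB.
have := @enlargement_r y; rewrite b0 addr0 invr1 powRr1 ?(ltW r0) // => h.
by apply: GK; rewrite b0; exact: h.
Qed.

(* With [p = (beta+1)/beta >= 2], for [l <= r] the quadratic regime of the
   maximum prevails: [l^p r^(1-p) <= l^2 / r]. *)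
Lemma mlsi_gradient_le (G : 'rV[R]_n) (l : R) : 0 < beta -> beta <= 1 ->
  0 < l <= r ->
  (forall k, enlargement n beta r k -> dot G k <= 1) ->
  lp_norm ((beta + 1) / beta) (l *: G) `^ ((beta + 1) / beta) <= l ^+ 2 / r.
Proof.
move=> b0 b1 /andP[l0 lr] GK; set p := (beta + 1) / beta.
have bN0 : beta != 0 by rewrite gt_eqF.
have p0 : 0 < p by rewrite divr_gt0 // addrC.
rewrite lp_norm_powR // lp_sumZ ?(ltW l0) //.
have pE : p = 2 + (p - 2) by ring.
have p2 : 0 <= p - 2.
  have -> : p - 2 = (1 - beta) / beta by rewrite /p; field.
  by rewrite divr_ge0 ?subr_ge0 // ltW.
have iE : beta^-1 = 1 + (p - 2) by rewrite /p; field.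
have := polar_enlargement_lp b0 GK; rewrite -/p iE => pol.
rewrite ler_pdivlMr // {1}pE powRD ?(gt_eqF l0) ?implybT //.
rewrite powR_mulrn ?(ltW l0) //.
have -> : l ^+ 2 * l `^ (p - 2) * lp_sum p G * r =
    l ^+ 2 * (l `^ (p - 2) * (lp_sum p G * r)) by ring.
rewrite ler_piMr ?sqr_ge0 //.
apply: le_trans pol.
rewrite [r `^ _]powRD ?(gt_eqF r0) ?implybT // powRr1 ?(ltW r0) //.
rewrite [lp_sum p G * r]mulrC mulrCA -mulrA ler_wpM2l ?(ltW r0) //.
rewrite ler_wpM2r ?lp_sum_ge0 //.
by apply: ge0_ler_powR; rewrite ?nnegrE ?(ltW r0) ?(ltW l0).
Qed.

Lemma mlsi_gradient2_le (G : 'rV[R]_n) (l : R) : 0 <= l ->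
  (forall k, enlargement n beta r k -> dot G k <= 1) ->
  lp_norm 2 (l *: G) ^+ 2 <= l ^+ 2 / r.
Proof.
move=> l0 GK; rewrite lp_norm2_sqr lp_sumZ // powR_mulrn //.
rewrite ler_wpM2l ?sqr_ge0 // -[leRHS]mul1r ler_pdivlMr // mulrC.
exact: polar_enlargement_l2.
Qed.

End enlargement.

(** The gradient of [l * h] is [l *: G] with [G] in the polar, so the gradient term is at most
    [l^2 / r]. For [beta = 0] the bound [r * |G_i| <= 1] and the restriction on [l] give the
    required bound on the partial derivatives. *)
Lemma mlsi_entropy_le (R : realType) (beta m sigma C r l : R)
    (d : measure_display) (T : measurableType d) (P : probability T R)
    (n : nat) (X : 'I_n -> {RV P >-> R}) (h : 'rV[R]_n -> R) :
  0 <= beta <= 1 -> 0 < m -> 0 <= sigma -> 0 < r ->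
  mlsi_constant beta m sigma C -> (0 < n)%N -> independent X ->
  (forall i, tail_class beta m (sigma `^ (beta + 1)) (distribution P (X i))) ->
  0 < l <= r ->
  (beta = 0 -> l * (2 * (m + 3 * sigma)) <= r) ->
  smooth (fun x => l * h x) ->
  convex_function (E := 'rV[R]_n) setT (fun x => l * h x) ->
  (forall x, exists G, (forall k, enlargement n beta r k -> dot G k <= 1) /\
     grad (fun x => l * h x) x = l *: G) ->
  bounded_rv (fun t => h (rvec X t)) ->
  (entropy P (fun t => expR (l * h (rvec X t))) <=
   (C * l ^+ 2 / r * mean P (fun t => expR (l * h (rvec X t))))%:E)%E.
Proof.
move=> /andP[b0 b1] m0 s0 r0 [C0 mlsi] n0 iX tX /andP[l0 lr] l_r sm cv gradE bh.
have [mlsi_pos mlsi_0] := mlsi _ _ P n X (fun x => l * h x) n0 iX tX sm cv.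
have be : bounded_rv (fun t => expR (l * h (rvec X t))).
  exact/bounded_rv_expR/bounded_rvZ.
have -> : ((C * l ^+ 2 / r * mean P (fun t => expR (l * h (rvec X t))))%:E =
    C%:E * 'E_P[fun t => (l ^+ 2 / r * expR (l * h (rvec X t)))%R])%E.
  by rewrite expectation_mean ?meanZ //; [rewrite -EFinM !mulrA | exact: bounded_rvZ].
have mono (F : T -> R) : (forall t, 0 <= F t <= l ^+ 2 / r) ->
    ('E_P[fun t => (F t * expR (l * h (rvec X t)))%R] <=
     'E_P[fun t => (l ^+ 2 / r * expR (l * h (rvec X t)))%R])%E.
  move=> HF; rewrite unlock; apply: le_ge0_integral => t _; rewrite !lee_fin.
  have /andP[F0 F1] := HF t.
  by rewrite mulr_ge0 ?expR_ge0 //= ler_wpM2r ?expR_ge0.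
have [beta_gt0|beta_le0] := ltP 0 beta.
  apply: (le_trans (mlsi_pos beta_gt0)); rewrite lee_pmul2l //; apply: mono => t.
  have [G [GK ->]] := gradE (rvec X t).
  rewrite le_max sqr_ge0 /= ge_max.
  by rewrite (mlsi_gradient2_le b0 r0 (ltW l0) GK) //= (mlsi_gradient_le b0 r0) // l0.
have beta_eq0 : beta = 0 by apply/eqP; rewrite eq_le beta_le0.
have L0 : 0 < m + 3 * sigma by rewrite ltr_wpDr // mulr_ge0.
have gb i x : `|partial i (fun x => l * h x) x| <= 1 / (2 * (m + 3 * sigma)).
  have [G [GK GE]] := gradE x.
  have -> : partial i (fun x => l * h x) x = l * G 0 i.
    by have := congr1 (fun v : 'rV[R]_n => v 0 i) GE; rewrite !mxE.
  rewrite normrM (gtr0_norm l0) ler_pdivlMr ?mulr_gt0 // mulrAC.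
  have := polar_enlargement_sup r0 beta_eq0 GK i; apply: le_trans.
  by rewrite ler_wpM2r // l_r.
apply: (le_trans (mlsi_0 beta_eq0 gb)); rewrite lee_pmul2l //; apply: mono => t.
have [G [GK ->]] := gradE (rvec X t).
by rewrite sqr_ge0 (mlsi_gradient2_le b0 r0 (ltW l0) GK).
Qed.

(** * Concentration *)

Lemma mu_extU_le (d : measure_display) (T : measurableType d) (R : realType)
    (P : probability T R) (D F G : set T) :
  measurable F -> measurable G -> D `<=` F `|` G ->
  (mu_ext P D <= P F + P G)%E.
Proof.
move=> mF mG DFG; apply: (le_trans (le_mu_ext P DFG)).
rewrite measurable_mu_extE; last exact: measurableU.
exact: measureU2.
Qed.

(** The clipped variables [Y] agree with [X] off [Qc], an event of probability at most [e]. There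
    [h <= 0] on the event of [A] and [h >= 3/4] on [D]; [e <= 1/10] yields the threshold 3/5 of the
    doubling lemma. *)
Lemma enlargement_concentration_eps (R : realType) (beta m sigma C r e : R)
    (d : measure_display) (T : measurableType d) (P : probability T R)
    (n : nat) (X : 'I_n -> {RV P >-> R}) (A : set 'rV[R]_n) :
  0 <= beta <= 1 -> 0 < m -> 0 <= sigma -> 0 < r -> 0 < e <= 1 / 10 ->
  mlsi_constant beta m sigma C -> (0 < n)%N -> independent X ->
  (forall i, tail_class beta m (sigma `^ (beta + 1)) (distribution P (X i))) ->
  cvx A -> ((2^-1)%:E <= mu_ext P [set w | A (rvec X w)])%E ->
  let D := [set w | ~ minkowski_sum A (enlargement n beta r) (rvec X w)] in
  (mu_ext P D <= (1 / 2 + 2 * e)%:E)%E /\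
  forall (k : nat) (s : R), 0 < s -> 2 ^+ k * s <= r ->
    (beta = 0 -> 2 ^+ k * s * (2 * (m + 3 * sigma)) <= r) ->
    expR (C * s ^+ 2 / r) <= (11 / 10) ^+ 2 ->
    (mu_ext P D <= (expR (- (3 / 4 * (2 ^+ k * s)) +
      (2 ^+ k * ln 100 + 2 * C * (2 ^+ k * s) ^+ 2 / r)) + e)%:E)%E.
Proof.
move=> b01 m0 s0 r0 /andP[e0 e1] hC n0 iX tX cA PA D.
have [b0 b1] := andP b01.
have C0 : 0 < C := hC.1.
have A0 : A !=set0.
  apply/set0P/eqP => A0; move: PA; rewrite A0 (_ : [set w | _] = set0) //.
  rewrite mu_ext0 //; first by rewrite lee_fin leNgt invr_gt0 ltr0n.
(* One threshold on [V] bounds all coordinates at once; [M >= m] is what clipping within the tail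
   class asks for. *)
pose V w := \sum_i `|X i w|.
have mV : measurable_fun setT V.
  by apply: measurable_sum => i; exact: measurableT_comp.
have [M mM PM] := measure_gt_small P m mV e0.
have M0 : 0 <= M by rewrite (le_trans _ mM) // ltW.
set Qc := [set w | _] in PM.
have mQc : measurable Qc.
  rewrite -[X in measurable X]setTI (_ : Qc = V @^-1` `]M, +oo[).
    by apply: mV => //; exact: measurable_itv.
  by apply/seteqP; split => w /=; rewrite in_itv /= andbT.
pose Y i : {RV P >-> R} := clip_rv M (X i).
have XM w : ~ Qc w -> forall i, `|X i w| <= M.
  rewrite /Qc /= => /negP; rewrite -leNgt => VM i; apply: le_trans VM.
  by rewrite /V (bigD1 i) //= lerDl; apply: sumr_ge0.
have XY w : ~ Qc w -> rvec Y w = rvec X w.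
  by move=> /XM wM; apply/rowP => i; rewrite !mxE /Y /= /clip_rv /= clip_id.
have bY i : bounded_rv (Y i).
  split; first exact: measurable_clip_rv.
  by exists M => w; exact: norm_clip_le.
have [h [hsm hA hD hb]] := smooth_separator M cA A0 (cvx_enlargement b0)
  (enlargement0 r b0) (absorbing_enlargement b0 r0).
have bh := hb _ _ P Y bY.
pose f w := h (rvec Y w).
pose F := [set w | 3 / 4 <= f w]; pose H := [set w | 0 < f w].
have mF : measurable F.
  rewrite -[X in measurable X]setTI (_ : F = f @^-1` `[3 / 4, +oo[).
    by apply: bh.1 => //; exact: measurable_itv.
  by apply/seteqP; split => w /=; rewrite in_itv /= andbT.
have mH : measurable H.
  rewrite -[X in measurable X]setTI (_ : H = f @^-1` `]0, +oo[).
    by apply: bh.1 => //; exact: measurable_itv.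
  by apply/seteqP; split => w /=; rewrite in_itv /= andbT.
have DF : D `<=` F `|` Qc.
  move=> w Dw; have [Qw|Qw] := pselect (Qc w); [by right | left].
  by rewrite /F /= /f XY //; apply: hD => // i; rewrite mxE; exact: XM.
have PD : (mu_ext P D <= P F + e%:E)%E.
  by apply: (le_trans (mu_extU_le P mF mQc DF)); rewrite leeD2l.
have PH : mean P \1_H <= 1 / 2 + e.
  have : ((2^-1)%:E <= P (~` H) + P Qc)%E.
    apply: (le_trans PA); apply: mu_extU_le => //; first exact: measurableC.
    move=> w Aw; have [Qw|Qw] := pselect (Qc w); [by right | left].
    by rewrite /H /= /f XY // ltNge => /negP; apply; exact: hA.
  rewrite probability_setC // -mean_indic //.
  move=> /le_trans/(_ (leeD2l _ PM)); rewrite -EFinB -EFinD lee_fin; lra.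
split.
  apply: (le_trans PD); rewrite -mean_indic // -EFinD lee_fin.
  have : mean P \1_F <= mean P \1_H.
    apply: le_mean => [||w]; [exact: bounded_rv_indic..|].
    rewrite !indicE ler_nat; case: (boolP (w \in F)) => // /set_mem Fw.
    by rewrite mem_set // /H /=; apply: lt_le_trans Fw; rewrite divr_gt0.
  lra.
move=> k s sg0 sr slr eps; apply: (le_trans PD); rewrite EFinD leeD2r //.
have sk0 j : 0 < 2 ^+ j * s by rewrite mulr_gt0 // exprn_gt0.
apply: (le_trans (mean_expR_markov P bh (sk0 k) mF)).
rewrite lee_fin expRD [2 ^+ k * s * (3 / 4)]mulrC ler_wpM2l ?expR_ge0 //.
apply: mean_expR_doubling => //; first by apply: (le_trans PH); lra.
move=> j jk; have jk2 : 2 ^+ j * s <= 2 ^+ k * s.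
  by rewrite ler_wpM2r ?(ltW sg0) // ler_eXn2l // ltr1n.
have [sm cv gr] := hsm _ (ltW (sk0 j)).
apply: (@mlsi_entropy_le R beta m sigma C r (2 ^+ j * s) _ _ P n Y h) => //.
- exact: independent_clip_rv.
- by move=> i; apply: tail_class_clip_rv => //; exact: powR_ge0.
- by rewrite sk0 (le_trans jk2).
- move=> /slr; apply: le_trans; rewrite ler_wpM2r //.
  by rewrite mulr_ge0 // addr_ge0 ?(ltW m0) // mulr_ge0.
Qed.

(** The event [D] and the bounds do not involve the clipping level, so [e] may tend to 0. *)
Lemma enlargement_concentration (R : realType) (beta m sigma C r : R)
    (d : measure_display) (T : measurableType d) (P : probability T R)
    (n : nat) (X : 'I_n -> {RV P >-> R}) (A : set 'rV[R]_n) :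
  0 <= beta <= 1 -> 0 < m -> 0 <= sigma -> 0 < r ->
  mlsi_constant beta m sigma C -> (0 < n)%N -> independent X ->
  (forall i, tail_class beta m (sigma `^ (beta + 1)) (distribution P (X i))) ->
  cvx A -> ((2^-1)%:E <= mu_ext P [set w | A (rvec X w)])%E ->
  let D := [set w | ~ minkowski_sum A (enlargement n beta r) (rvec X w)] in
  (mu_ext P D <= (1 / 2)%:E)%E /\
  forall (k : nat) (s : R), 0 < s -> 2 ^+ k * s <= r ->
    (beta = 0 -> 2 ^+ k * s * (2 * (m + 3 * sigma)) <= r) ->
    expR (C * s ^+ 2 / r) <= (11 / 10) ^+ 2 ->
    (mu_ext P D <= (expR (- (3 / 4 * (2 ^+ k * s)) +
      (2 ^+ k * ln 100 + 2 * C * (2 ^+ k * s) ^+ 2 / r)))%:E)%E.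
Proof.
move=> b01 m0 s0 r0 hC n0 iX tX cA PA D.
pose e' (e : R) := Num.min (e / 2) (1 / 10).
have e'P e : 0 < e -> 0 < e' e <= 1 / 10.
  by move=> e0; rewrite /e' lt_min ge_min lexx orbT andbT divr_gt0 //=; lra.
have e'e e : 2 * e' e <= e.
  by rewrite -ler_pdivlMl // mulrC /e' ge_min lexx.
have H e (e0 : 0 < e) :=
  enlargement_concentration_eps b01 m0 s0 r0 (e'P e e0) hC n0 iX tX cA PA.
split.
  apply/lee_addgt0Pr => e e0; apply: (le_trans (H e e0).1).
  by rewrite -EFinD lee_fin lerD2l e'e.
move=> k s sg0 sr slr eps; apply/lee_addgt0Pr => e e0.
apply: (le_trans ((H e e0).2 k s sg0 sr slr eps)); rewrite -EFinD lee_fin lerD2l.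
have /andP[e'0 _] := e'P e e0; have := e'e e; lra.
Qed.

(** Taking [s = b sqrt r] makes [C s^2 / r] the constant 1/10, and [k] puts [z = 2^k s] between
    [t r / 2] and [t r]. Both positive terms are then at most [z / 4], leaving
    [- z / 4 <= - t r / 8]. *)
Lemma dyadic_scale (R : realType) (C B : R) : 0 < C -> 1 <= B ->
  exists tau r0 : R, [/\ 0 < tau, 0 < r0 & forall r, r0 <= r ->
    exists (k : nat) (s : R),
      [/\ 0 < s, 2 ^+ k * s * B <= r, expR (C * s ^+ 2 / r) <= (11 / 10) ^+ 2 &
          - (3 / 4 * (2 ^+ k * s)) +
          (2 ^+ k * ln 100 + 2 * C * (2 ^+ k * s) ^+ 2 / r) <= - (tau * r)]].
Proof.
move=> C0 B1; have B0 : 0 < B by lra.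
pose b : R := Num.sqrt (10 * C)^-1.
have b0 : 0 < b by rewrite sqrtr_gt0 invr_gt0 mulr_gt0.
have b2 : C * b ^+ 2 = 1 / 10.
  by rewrite sqr_sqrtr ?invr_ge0 ?mulr_ge0 ?(ltW C0) //; field; rewrite gt_eqF.
pose t : R := Num.min B^-1 (8 * C)^-1.
have t0 : 0 < t by rewrite lt_min !invr_gt0 B0 mulr_gt0.
have tB : t * B <= 1 by rewrite -ler_pdivlMr // mul1r ge_min lexx.
have tC : 8 * C * t <= 1.
  by rewrite mulrC -ler_pdivlMr ?mulr_gt0 // mul1r ge_min lexx orbT.
have l100 : 0 < ln 100 :> R by rewrite ln_gt0 // ltr1n.
(* For [r >= q^2] the two summands give [s >= 4 ln 100] and [t r / s >= 1]; the latter lets [k]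
   exist. *)
pose q : R := 4 * ln 100 / b + b / t.
have q0 : 0 < q by rewrite addr_gt0 // divr_gt0 // mulr_gt0.
exists (t / 8), (q ^+ 2); split; [by rewrite divr_gt0|by rewrite exprn_gt0|].
move=> r qr; have r0 : 0 < r by rewrite (lt_le_trans _ qr) // exprn_gt0.
pose y := Num.sqrt r; have y0 : 0 < y by rewrite sqrtr_gt0.
have y2 : y ^+ 2 = r by rewrite sqr_sqrtr // ltW.
have qy : q <= y by rewrite -ler_sqr ?nnegrE ?(ltW q0) ?(ltW y0) // y2.
have yl : 4 * ln 100 <= b * y.
  rewrite [b * y]mulrC -ler_pdivrMr //; apply: le_trans qy.
  by rewrite lerDl divr_ge0 // ltW.
have yt : b <= t * y.
  rewrite [t * y]mulrC -ler_pdivrMr //; apply: le_trans qy.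
  by rewrite lerDr divr_ge0 ?mulr_ge0 // ltW.
pose s := b * y; have s0 : 0 < s by exact: mulr_gt0.
have [k /andP[k1 k2]] : exists k, 2 ^+ k <= t * r / s < 2 ^+ k.+1.
  have x1 : 1 <= t * r / s.
    by rewrite ler_pdivlMr // mul1r /s -y2 expr2 mulrA ler_wpM2r // ltW.
  have x0 : 0 <= t * r / s by lra.
  exists (trunc_log 2 (Num.truncn (t * r / s))).
  have /andP[h1 h2] := truncn_itv x0.
  have tr0 : (0 < Num.truncn (t * r / s))%N by rewrite truncn_gt0.
  have /andP[h3 h4] := @trunc_log_bounds 2 (Num.truncn (t * r / s)) isT tr0.
  rewrite -!natrX; apply/andP; split; first by apply: le_trans h1; rewrite ler_nat.
  by apply: (lt_le_trans h2); rewrite ler_nat.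
exists k, s; set z := 2 ^+ k * s.
have z0 : 0 < z by rewrite mulr_gt0 // exprn_gt0.
have zr : z <= t * r by rewrite -ler_pdivlMr.
have rz : t * r <= 2 * z by rewrite /z mulrA -exprS -ler_pdivrMr // ltW.
split => //.
- by rewrite (le_trans (ler_wpM2r (ltW B0) zr)) // mulrAC ler_piMl // ltW.
- have -> : C * s ^+ 2 / r = 1 / 10.
    by rewrite /s exprMn y2 mulrA b2 mulfK // gt_eqF.
  (* From [expR (- 1/10) >= 9/10] follows [expR (1/10) <= 10/9], below [(11/10)^2]. *)
  have := @expR_ge1Dx R (- (1 / 10)); rewrite expRN.
  set E := expR _; have E0 : 0 < E by exact: expR_gt0.
  rewrite -(ler_pM2r E0) mulVf ?gt_eqF //; lra.
- have : 2 ^+ k * ln 100 <= z / 4.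
    rewrite /z -mulrA ler_wpM2l ?exprn_ge0 //; rewrite /s; lra.
  have : 2 * C * z ^+ 2 / r <= z / 4.
    rewrite ler_pdivrMr //.
    have C2 : 0 <= 2 * C by rewrite mulr_ge0 // ltW.
    have := ler_wpM2l C2 (ler_wpM2l (ltW z0) zr).
    have := ler_wpM2l (ltW (mulr_gt0 z0 r0)) tC; lra.
  lra.
Qed.

(* C' is chosen before m, sigma, n and the random variables, so it depends only
   on beta, C and L. The parameter L plays the role of m + 3 sigma; for
   beta > 0 it is unrelated to m and sigma (take for instance L = 0), so that
   C' then depends on beta and C alone.
   Convex sets need not be Borel, so probabilities of events are written with
   the outer measure [mu_ext P], equal to P on measurable sets. *)
Theorem corollary1p8 (R : realType) (beta C L : R) :
  0 <= beta <= 1 -> 0 < C ->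
  exists C' : R, 0 < C' /\
  forall m sigma : R, 0 < m -> 0 <= sigma ->
  (beta = 0 -> m + 3 * sigma = L) ->
  mlsi_constant beta m sigma C ->
  forall (d : measure_display) (T : measurableType d) (P : probability T R)
    (n : nat) (X : 'I_n -> {RV P >-> R}) (A : set 'rV[R]_n),
  (0 < n)%N ->
  independent X ->
  (forall i, tail_class beta m (sigma `^ (beta + 1)) (distribution P (X i))) ->
  convex_set (M := 'rV[R]_n) A ->
  ((2^-1)%:E <= mu_ext P [set w | A (rvec X w)])%E ->
  forall r : R, 0 <= r ->
  (mu_ext P [set w | ~ minkowski_sum
                         (minkowski_sum A (dilate (r `^ 2^-1) (lp_ball n 2)))
                         (dilate (r `^ (1 + beta)^-1) (lp_ball n (1 + beta)))
                         (rvec X w)]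
   <= (expR (- (C' * r)))%:E)%E.
Proof.
(* Both [1 <= B] and [2 L <= B] hold, so [2^k s B <= r] implies the two upper limits on the
   scale. *)
move=> b01 C0; pose B : R := 2 * (`|L| + 1).
have B1 : 1 <= B by have := normr_ge0 L; rewrite /B; lra.
have [tau [r0 [tau0 r00 scale]]] := dyadic_scale C0 B1.
have ln20 : 0 < ln 2 :> R by rewrite ln_gt0 // ltr1n.
(* The rate [tau] serves for [r >= r0]; for [r < r0] the rate [ln 2 / r0] keeps the claimed bound
   above 1/2. *)
exists (Num.min tau (ln 2 / r0)); split; first by rewrite lt_min tau0 divr_gt0.
move=> m sigma m0 s0 mL hC d T P n X A n0 iX tX convA PA r.
rewrite -minkowski_sumA -/(enlargement n beta r).
rewrite le_eqVlt => /predU1P[<-|rpos].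
  rewrite mulr0 oppr0 expR0; apply: (le_trans (le_mu_ext P (@subsetT _ _))).
  by rewrite measurable_mu_extE // probability_le1.
have cA : cvx A.
  move=> x y t t01 Ax Ay; have t1 : t <= 1 by case/andP: t01.
  have t0 : 0 <= t by case/andP: t01.
  by have := convA x y (Itv01 t0 t1) (mem_set Ax) (mem_set Ay) => /set_mem.
have [half small] := enlargement_concentration b01 m0 s0 rpos hC n0 iX tX cA PA.
have [r0r|rr0] := leP r0 r.
  have [k [s [sg0 sB eps bound]]] := scale r r0r.
  have ks0 : 0 <= 2 ^+ k * s by rewrite mulr_ge0 ?exprn_ge0 // ltW.
  apply: (le_trans (small k s sg0 _ _ eps)).
  - by apply: le_trans sB; rewrite ler_peMr.
  - move=> /mL ->; apply: le_trans sB; rewrite ler_wpM2l // /B.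
    by have := ler_norm L; lra.
  rewrite lee_fin ler_expR (le_trans bound) // lerN2 ler_wpM2r ?(ltW rpos) //.
  by rewrite ge_min lexx.
apply: (le_trans half).
have -> : 1 / 2 = expR (- ln 2) :> R by rewrite expRN lnK ?posrE // mul1r.
rewrite lee_fin ler_expR lerN2.
apply: (@le_trans _ _ (ln 2 / r0 * r)).
  by rewrite ler_wpM2r ?(ltW rpos) // ge_min lexx orbT.
by rewrite mulrAC ler_pdivrMr // ler_wpM2l // ltW.
Qed.
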